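(* For each $n\in\mathbb N$ let $(U(s,n))_{s\in S}$ be an independent family of $n\times n$ standard unitary random matrices. Let $l\ge1$, $s_1,\dots,s_l\in S$, $m_1,\dots,m_l\in\mathbb Z\setminus\{0\}$, and let $R_p\ge0$, $p\ge1$, be constants. Then $$E\Big(\big|tr_n\big(U(s_1,n)^{m_1}D_1(n)U(s_2,n)^{m_2}D_2(n)\cdots U(s_l,n)^{m_l}D_l(n)\big)\big|^2\Big)$$ is $O(n^{-2})$ as $n\to\infty$, uniformly for the choice of any $D_r(n)\in M_n(\mathbb C)$ ($1\le r\le l$) such that for each $1\le r\le l$ either $$tr_n(D_r(n))=0\ \text{ and }\ \|D_r(n)\|_p\le R_p\quad(n\in\mathbb N,\ p\ge1),$$ or $$D_r(n)=I_n\quad(n\in\mathbb N)\ \text{ and }\ s_r\ne s_{r+1}\ (\text{with } s_{l+1}=s_1).$$ Also, for a given $l$, there exists a $p_l$ such that the same statement holds as long as the $\|\cdot\|_p$-norm bounds are satisfied for $p\le p_l$ only.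
   Context: $tr_n$ is the normalized trace on $M_n(\mathbb C)$. $\|A\|_p=tr_n(|A|^p)^{1/p}$, with $|A|=(A^*A)^{1/2}$, is the Schatten $p$-norm with respect to $tr_n$. An $n\times n$ unitary random matrix is standard unitary if its distribution is the Haar probability measure on the unitary group $\mathcal U(n)$. ''Uniformly'' means that the constant implied in $O(n^{-2})$ depends only on $l$, $s_1,\dots,s_l$, $m_1,\dots,m_l$ and the constants $R_p$, and not on the chosen $D_r(n)$. *)

(* Defs.v *)
From HB Require Import structures.
From mathcomp Require Import all_boot all_order all_algebra.
From mathcomp Require Import complex.
From mathcomp Require Import all_classical all_reals all_analysis.

Set Implicit Arguments.
Unset Strict Implicit.
Unset Printing Implicit Defensive.

Import Order.TTheory GRing.Theory Num.Theory.
Import numFieldNormedType.Exports.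

Local Open Scope classical_set_scope.
Local Open Scope ring_scope.
Local Open Scope complex_scope.
Local Open Scope sesquilinear_scope.

(* Analysis attaches its topology to the sorts of numeric structures and not
   to the bare type R[i], hence this packed copy of it. *)
Definition Cplx (R : realType) : numClosedFieldType := R[i].

(* Matrix sizes are written n.+1 throughout, so that n.+1 ranges over the
   positive integers and square matrices form a unit ring. *)
Definition trn (R : realType) (n : nat) (A : 'M[Cplx R]_n.+1) : Cplx R :=
  \tr A / n.+1%:R.

(* Continuous functional calculus; meaningful for normal A, for which
   A = invmx (spectralmx A) *m diag_mx (spectral_diag A) *m spectralmx A. *)
Definition specfun (R : realType) (n : nat) (f : Cplx R -> Cplx R)
    (A : 'M[Cplx R]_n.+1) : 'M[Cplx R]_n.+1 :=
  invmx (spectralmx A) *m diag_mx (map_mx f (spectral_diag A)) *m spectralmx A.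

Definition mxabs (R : realType) (n : nat) (A : 'M[Cplx R]_n.+1) :
    'M[Cplx R]_n.+1 :=
  specfun sqrtC (A ^t* *m A).

(* The real power A ^ p of a positive semidefinite matrix A. *)
Definition mxpowR (R : realType) (n : nat) (A : 'M[Cplx R]_n.+1) (p : R) :
    'M[Cplx R]_n.+1 :=
  specfun (fun z => (complex.Re z `^ p)%:C) A.

Definition schatten (R : realType) (n : nat) (p : R) (A : 'M[Cplx R]_n.+1) : R :=
  complex.Re (trn (mxpowR (mxabs A) p)) `^ p^-1.

(* Square matrices with their Borel sigma-algebra. *)
Definition mxborel (R : realType) (n : nat) :=
  g_sigma_algebraType (@open 'M[Cplx R]_n.+1).

(* mu is the Haar probability measure of the unitary group, seen as a Borel
   probability measure on all matrices that is carried by the unitary group. *)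
Definition unitary_haar (R : realType) (n : nat)
    (mu : set (mxborel R n) -> \bar R) : Prop :=
  mu [set V : 'M[Cplx R]_n.+1 | V \is unitarymx] = 1%E /\
  forall (V : 'M[Cplx R]_n.+1) (A : set (mxborel R n)),
    V \is unitarymx -> measurable A ->
    mu [set V *m W | W in (A : set 'M[Cplx R]_n.+1)] = mu A.

Definition standard_unitary (R : realType) (n : nat) (d : measure_display)
    (T : measurableType d) (P : probability T R)
    (U : {RV P >-> mxborel R n}) : Prop :=
  unitary_haar (distribution P U).

Definition independent_RVs (R : realType) (d d' : measure_display)
    (T : measurableType d) (T' : measurableType d') (P : probability T R)
    (I : Type) (X : I -> {RV P >-> T'}) : Prop :=
  forall (k : nat) (t : 'I_k -> I) (A : 'I_k -> set T'),
    injective t -> (forall j, measurable (A j)) ->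
    P (\bigcap_j (X (t j) @^-1` A j)) =
    (\prod_(j < k) P (X (t j) @^-1` A j))%E.

(* tr_n(U(s_1)^{m_1} D_1 ... U(s_l)^{m_l} D_l); the product is taken in
   increasing order of the index. *)
Definition word_trace (R : realType) (n l : nat) (S : Type) (s : 'I_l -> S)
    (m : 'I_l -> int) (U : S -> 'M[Cplx R]_n.+1)
    (D : 'I_l -> 'M[Cplx R]_n.+1) : Cplx R :=
  trn (\prod_(r < l) (U (s r) ^ m r * D r)).

(* Admissible deterministic sequences, with norm bounds imposed for the
   exponents p in J. The map ordS is the cyclic successor of 'I_l. *)
Definition admissible (R : realType) (l : nat) (S : Type) (s : 'I_l -> S)
    (B : R -> R) (J : set R) (D : 'I_l -> forall n : nat, 'M[Cplx R]_n.+1) :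
    Prop :=
  forall r : 'I_l,
    (forall n : nat, trn (D r n) = 0 /\
       (forall p, J p -> schatten p (D r n) <= B p)) \/
    ((forall n : nat, D r n = 1%:M) /\ s r <> s (ordS r)).

(* The second moment of the trace is O(n^-2): the implied constant K and the
   rank N are chosen before the random matrices and before D. *)
Definition second_moment_bound (R : realType) (l : nat) (S : Type)
    (s : 'I_l -> S) (m : 'I_l -> int) (B : R -> R) (J : set R) : Prop :=
  exists (K : R) (N : nat),
  forall (d : nat -> measure_display) (T : forall n, measurableType (d n))
    (P : forall n, probability (T n) R)
    (U : forall n, S -> {RV (P n) >-> mxborel R n})
    (D : 'I_l -> forall n : nat, 'M[Cplx R]_n.+1),
    (forall n a, standard_unitary (U n a)) ->
    (forall n, independent_RVs (U n)) ->
    admissible s B J D ->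
    forall n, (N <= n)%N ->
    ('E_(P n)[fun w =>
        (complex.Re `|word_trace s m (fun a => U n a w) (D ^~ n)| ^+ 2)%R]
      <= (K / n.+1%:R ^+ 2)%:E)%E.

(* Main.v *)
(* Write the product as a word in the letters u_j, u_j^* and D_r. Dropping the
   identity matrices D_r leaves a word which is reduced: no u_j stands next to
   its inverse and no two D's are adjacent; all remaining D's have trace 0.
   Every such word W satisfies E|tr W|^2 = O(n^-2), by induction on its length.

   Invariance of the Haar measure under u_j -> V u_j yields a loop equation: if
   W begins with u_j, then, writing tr for the normalized trace,
     E(tr W * conj(tr W)) = - sum E(tr(u_j p) tr(u_j q) conj(tr W))
                            + sum E(tr(p) tr(q) conj(tr W)) + O(n^-2),
   summed over the factorizations W = u_j p u_j q and W = u_j p u_j^* q. The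
   words u_j p and p are subwords of W, hence reduced and shorter, whereas the
   other trace is bounded, by a Hoelder inequality in which only the matrices D
   are counted. A leading D is first moved to the end of W cyclically; being a
   suffix, it never occurs in u_j p or p. *)
Require Import Defs.
From mathcomp Require Import all_boot all_order all_algebra.
From mathcomp Require Import spectral sesquilinear complex.
From mathcomp Require Import all_classical all_reals all_analysis.
From mathcomp Require Import measurable_realfun.
From mathcomp Require Import zify ring lra.
Set Implicit Arguments.
Unset Strict Implicit.
Unset Printing Implicit Defensive.
Import Order.TTheory GRing.Theory Num.Theory.
Import numFieldNormedType.Exports.
Local Open Scope ring_scope.
Local Open Scope sesquilinear_scope.

(** * Normalized trace and Hoelder inequality *)

(** The induction closes by absorption. One of the two traces in each term of the loop equation is
    at most [b], so a weighted arithmetic-geometric inequality leaves half of E|tr W|^2, which moves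
    to the left side, plus multiples of E|tr W'|^2 for shorter reduced words W'. The merged words in
    the O(n^-2) term carry the constants of W and of its adjoint, at most 2l of them. Unitary
    letters cost nothing in the Hoelder inequality, and 2l < 2^(l+1), so the single exponent p_l =
    2^(l+1) suffices.

    No calculus on the unitary group is used: for a projection Q the matrix 1 + tQ is unitary
    whenever |1 + t| = 1, and a first order expansion along this circle replaces the derivative.
    This algebra takes place over an abstract [expectation_form]; measure theory enters when that
    structure is instantiated and the invariance is checked.

    Two obstacles shape the last parts. Haar matrices are unitary only almost surely, while bounds
    and expansions are wanted everywhere. Also, the integrand of the statement need not be
    measurable. Both are met by passing to unitarized matrices and comparing integrals almost
    everywhere. *)

Section NormalizedTrace.
Variables (C : numClosedFieldType) (n : nat).
Local Notation M := 'M[C]_n.+1.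
Implicit Types A B X Y : M.

(* The trace trn of the statement, over an arbitrary closed field. *)
Definition ntr A : C := \tr A / n.+1%:R.

Lemma adjmxM A B : (A * B)^t* = B^t* * A^t*.
Proof. by rewrite -!mulmxE trmx_mul map_mxM. Qed.

Lemma adjmx1 : (1 : M)^t* = 1.
Proof. by rewrite -idmxE trmx1 map_mx1. Qed.

Lemma adjmxX A k : (A ^+ k)^t* = (A^t*) ^+ k.
Proof. by elim: k => [|k IH]; rewrite ?expr0 ?adjmx1// exprS adjmxM IH -exprSr. Qed.

Lemma ntrC A B : ntr (A * B) = ntr (B * A).
Proof. by rewrite /ntr -!mulmxE mxtrace_mulC. Qed.

Lemma ntr1 : ntr 1 = 1.
Proof. by rewrite /ntr -idmxE mxtrace1 divff// pnatr_eq0. Qed.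

Lemma ntr_adj A : ntr (A^t*) = (ntr A)^*.
Proof.
rewrite /ntr rmorphM/= fmorphV/= conjC_nat; congr (_ / _).
by rewrite /mxtrace rmorph_sum/=; apply: eq_bigr => i _; rewrite !mxE.
Qed.

Lemma ntr_gram_ge0 A : 0 <= ntr (A * A^t*).
Proof.
apply: mulr_ge0; last by rewrite invr_ge0 ler0n.
apply: sumr_ge0 => i _; rewrite mxE; apply: sumr_ge0 => j _.
by rewrite !mxE -normCK exprn_ge0.
Qed.

Lemma ntr_adj_gram_ge0 A : 0 <= ntr (A^t* * A).
Proof. by rewrite ntrC ntr_gram_ge0. Qed.

Lemma mxtrace_dotmx A B : \tr (A * B) = dotmx (mxvec A) (mxvec (B^t*)).
Proof.
rewrite dotmxE mxE -mulmxE /mxtrace.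
under eq_bigr do rewrite mxE.
rewrite pair_big/= (reindex _ (curry_mxvec_bij _ _))/=.
apply: eq_bigr => -[i j] _ /=.
by rewrite !mxvecE !mxE mxvecE !mxE conjCK.
Qed.

Lemma ntr_CauchySchwarz A B :
  `|ntr (A * B)| ^+ 2 <= ntr (A * A^t*) * ntr (B^t* * B).
Proof.
have h : `|\tr (A * B)| ^+ 2 <= \tr (A * A^t*) * \tr (B^t* * B).
  by rewrite !mxtrace_dotmx trmxCK; exact: leif_le (CauchySchwarz _ _ _).
rewrite /ntr normrM normfV normr_nat mulrACA -invfM -expr2 exprMn exprVn.
by rewrite ler_pM2r// invr_gt0 exprn_gt0// ltr0n.
Qed.

End NormalizedTrace.

Section Chessboard.
Variables (C : numClosedFieldType) (n : nat).
Local Notation M := 'M[C]_n.+1.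

(* Chessboard estimate: take a word of maximal |tr| and let it start with a run
   (X^* X)^(2^j). By the Cauchy-Schwarz inequality for its two halves, reflecting
   the first half doubles the run without decreasing |tr|; in the end the run
   fills the whole word. *)
Lemma ntr_chessboard (I : finType) (s : I -> I) (X : I -> M) (k : nat) (b : C) :
  (forall i, X (s i) = (X i)^t*) -> 0 <= b ->
  (forall i, `|ntr (((X i)^t* * X i) ^+ (2 ^ k))| <= b) ->
  forall w : seq I, size w = (2 ^ k.+1)%N -> `|ntr (\prod_(i <- w) X i)| <= b.
Proof.
move=> Xs b0 Xb w sw.
pose ev (v : seq I) := \prod_(i <- v) X i.
have evcat v1 v2 : ev (v1 ++ v2) = ev v1 * ev v2 by rewrite /ev big_cat.
have [v' ev'] : exists v', forall v, ev (v' v) = (ev v)^t* /\ size (v' v) = size v.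
  exists (fun v => rev (map s v)); move=> v; split; last by rewrite size_rev size_map.
  elim: v => [|i v IH]; first by rewrite /ev !big_nil adjmx1.
  rewrite /= rev_cons -cats1 evcat IH.
  by rewrite /ev big_seq1 big_cons adjmxM Xs.
pose f (t : (2 ^ k.+1).-tuple I) := `|ntr (ev t)|.
have freal t : true -> f t \is Num.real by rewrite normr_real.
have st : size w == (2 ^ k.+1)%N by apply/eqP.
case: (real_arg_maxP (isT : xpredT (Tuple st)) freal) => t _ tmax.
apply: le_trans (tmax (Tuple st) isT) _; set c := f t in tmax *.
have cmax v : size v = (2 ^ k.+1)%N -> `|ntr (ev v)| <= c.
  by move/eqP=> sv; exact: (tmax (Tuple sv) isT).
have [->//|c_neq0] := eqVneq c 0.
have c_gt0 : 0 < c by rewrite lt_def c_neq0 normr_ge0.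
have split_le v1 v2 : size v2 = (2 ^ k)%N -> c <= `|ntr (v1 * ev v2)| ->
    c <= `|ntr (v1 * v1^t*)|.
  move=> sv2 cle.
  have h := ntr_CauchySchwarz v1 (ev v2).
  have h2 : ntr ((ev v2)^t* * ev v2) <= c.
    rewrite -[X in X <= _]ger0_norm ?ntr_adj_gram_ge0// -(ev' v2).1 -evcat.
    by apply: cmax; rewrite size_cat (ev' v2).2 sv2 expnS; lia.
  rewrite -(ler_pM2r c_gt0) -expr2.
  apply: le_trans (_ : _ <= `|ntr (v1 * ev v2)| ^+ 2) _.
    by rewrite lerXn2r// ?nnegrE ?normr_ge0// ltW.
  apply: le_trans h _; rewrite ger0_norm ?ntr_gram_ge0//.
  by apply: ler_wpM2l; rewrite ?ntr_gram_ge0.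
have run j : (j <= k)%N -> exists i v, (size v = 2 ^ k.+1 - 2 ^ j.+1)%N /\
    c <= `|ntr (((X i)^t* * X i) ^+ (2 ^ j) * ev v)|.
  elim: j => [_|j IH jk].
    have := size_tuple t; case E : (tval t) => [|i v].
      by move=> /= /esym/eqP; rewrite expn_eq0.
    move=> /= sv; have lk : (0 < 2 ^ k)%N by rewrite expn_gt0.
    pose v1 := take (2 ^ k - 1) v; pose v2 := drop (2 ^ k - 1) v.
    rewrite expnS in sv.
    (* [v' v1] spells the adjoint of [v1]: up to rotation the new word is the half [X i * ev v1]
       times its mirror image, and the two copies of letter [i] meet. *)
    exists i, (v1 ++ v' v1); split.
      by rewrite size_cat (ev' _).2 /v1 size_take expn1 expnS; case: ifP; lia.
    have {1}-> : ntr (((X i)^t* * X i) ^+ (2 ^ 0) * ev (v1 ++ v' v1)) =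
        ntr ((X i * ev v1) * (X i * ev v1)^t*).
      by rewrite adjmxM mulrA [RHS]ntrC evcat (ev' _).1 !mulrA expr1.
    apply: (@split_le _ v2); first by rewrite size_drop; lia.
    by rewrite -mulrA -evcat cat_take_drop /c /f E /ev big_cons.
  have [i [v [sv cle]]] := IH (ltnW jk).
  set P := (X i)^t* * X i in cle *.
  have lk : (2 ^ j.+1 <= 2 ^ k)%N by rewrite leq_exp2l.
  pose v1 := take (2 ^ k - 2 ^ j.+1) v; pose v2 := drop (2 ^ k - 2 ^ j.+1) v.
  rewrite (expnS _ k) in sv.
  exists i, (v1 ++ v' v1); split.
    by rewrite size_cat (ev' _).2 /v1 size_take (expnS _ k) (expnS _ j.+1); case: ifP; lia.
  have Pa : (P ^+ (2 ^ j))^t* = P ^+ (2 ^ j) by rewrite adjmxX /P adjmxM trmxCK.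
  have -> : ntr (P ^+ (2 ^ j.+1) * ev (v1 ++ v' v1)) =
      ntr ((P ^+ (2 ^ j) * ev v1) * (P ^+ (2 ^ j) * ev v1)^t*).
    rewrite adjmxM Pa mulrA [RHS]ntrC evcat (ev' _).1 !mulrA -exprD.
    by rewrite addnn -mul2n -expnS.
  apply: (@split_le _ v2); first by rewrite size_drop; lia.
  by rewrite -mulrA -evcat cat_take_drop.
have [i [v [sv cle]]] := run k (leqnn k).
move: sv; rewrite subnn => /size0nil v0; apply: le_trans cle _.
by rewrite v0 /ev big_nil mulr1.
Qed.

(** This is the Schatten norm of exponent 2^(k+1), raised to that exponent, written without real
    powers. *)
Definition power_bound (k : nat) (b : C) (A : M) :=
  `|ntr ((A^t* * A) ^+ (2 ^ k))| <= b.

Lemma power_bound1 k b : 1 <= b -> power_bound k b 1.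
Proof. by move=> b1; rewrite /power_bound adjmx1 mulr1 expr1n ntr1 normr1. Qed.

(** This makes unitary letters free in the Hoelder inequality: each is absorbed by a neighbouring
    factor. *)
Lemma power_bound_unitary k b (V A : M) :
  V^t* * V = 1 -> power_bound k b A -> power_bound k b (V * A).
Proof.
by move=> VV; rewrite /power_bound adjmxM -mulrA [V^t* * _]mulrA VV mul1r.
Qed.

Lemma power_bound_adj k b A : power_bound k b A -> power_bound k b (A^t*).
Proof.
rewrite /power_bound trmxCK.
have : (0 < 2 ^ k)%N by rewrite expn_gt0.
case: (2 ^ k)%N => // m _.
have -> : (A * A^t*) ^+ m.+1 = A * (A^t* * A) ^+ m * A^t*.
  elim: m => [|m IH]; first by rewrite expr1 expr0 mulr1.
  by rewrite exprS IH [in RHS]exprS !mulrA.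
by rewrite -mulrA ntrC -mulrA -exprSr.
Qed.

(** Padding with identities, harmless because 1 <= b, gives the length that the chessboard estimate
    requires. Its alphabet consists of the positions of the padded list, each in two copies so as to
    be closed under adjoints. *)
Lemma ntr_Hoelder k b (L : seq M) : 1 <= b -> (size L <= 2 ^ k.+1)%N ->
  (forall A, A \in L -> power_bound k b A) -> `|ntr (\prod_(A <- L) A)| <= b.
Proof.
move=> b1 sL bL.
pose L' := L ++ nseq (2 ^ k.+1 - size L) 1.
have bL' A : A \in L' -> power_bound k b A.
  rewrite mem_cat => /orP[/bL//|]; rewrite mem_nseq => /andP[_ /eqP->].
  exact: power_bound1.
have sL' : size L' = (2 ^ k.+1)%N by rewrite size_cat size_nseq subnKC.
pose X (i : bool * 'I_(size L')) := if i.1 then L'`_i.2 else (L'`_i.2)^t*.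
have := @ntr_chessboard _ (fun i => (~~ i.1, i.2)) X k b _ _ _
  [seq (true, i) | i <- index_enum 'I_(size L')].
have -> : \prod_(i <- [seq (true, i) | i <- index_enum 'I_(size L')]) X i = \prod_(A <- L) A.
  rewrite big_map /X/= -(big_mkord xpredT (fun i => L'`_i)).
  rewrite -(big_nth 0 xpredT id) /L' big_cat/= big_nseq iter_mulr_1 expr1n mulr1//.
apply.
- by move=> [[] i]; rewrite /X//= trmxCK.
- exact: le_trans ler01 b1.
- move=> [c i]; have := bL' _ (mem_nth 0 (ltn_ord i)); rewrite /X/=.
  by case: c => // /power_bound_adj.
- by rewrite size_map /index_enum unlock -enumT size_enum_ord.
Qed.

End Chessboard.

(** * Words *)

Section Words.
Variables (C : numClosedFieldType) (n : nat) (J : eqType) (I : Type).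
Local Notation M := 'M[C]_n.+1.

(** The boolean is false for an adjoint; [inl] refers to a random unitary and [inr] to a
    deterministic matrix. *)
Definition letter : Type := (bool * (J + I))%type.

Implicit Types (w z : seq letter) (a : letter).

Definition letter_mx (U : J -> M) (D : I -> M) (a : letter) : M :=
  let A := match a.2 with inl j => U j | inr i => D i end in
  if a.1 then A else A^t*.

Definition word_mx (U : J -> M) (D : I -> M) w : M :=
  \prod_(a <- w) letter_mx U D a.

Definition word_adj w := rev [seq (~~ a.1, a.2) | a <- w].

Definition is_const a := if a.2 is inr _ then true else false.

Definition nconst w := count is_const w.

Definition compatible (a c : letter) : bool :=
  match a.2, c.2 with
  | inl i, inl j => (i != j) || (a.1 == c.1)
  | inr _, inr _ => false
  | _, _ => true
  end.

Definition reduced w := sorted compatible w.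

(* The letters u_j and u_j^* at which the derivative of a word in the direction
   U_j -> (1 + t A) U_j does not vanish; an item (e, x, y) stands for the
   summand e x A y of that derivative. *)
Fixpoint split_terms (j : J) z w : seq (bool * (seq letter * seq letter)) :=
  if w is a :: w' then
    (if a.2 is inl i then
       if i == j then [:: (a.1, if a.1 then (z, w) else (rcons z a, w'))]
       else [::]
     else [::]) ++ split_terms j (rcons z a) w'
  else [::].

Lemma word_mx_cat U D w z : word_mx U D (w ++ z) = word_mx U D w * word_mx U D z.
Proof. by rewrite /word_mx big_cat. Qed.

Lemma word_mx_cons U D a w : word_mx U D (a :: w) = letter_mx U D a * word_mx U D w.
Proof. by rewrite /word_mx big_cons. Qed.

Lemma word_mx_nil U D : word_mx U D [::] = 1.
Proof. by rewrite /word_mx big_nil. Qed.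

Lemma word_mx1 U D a : word_mx U D [:: a] = letter_mx U D a.
Proof. by rewrite /word_mx big_seq1. Qed.

Lemma word_mx_rcons U D w a : word_mx U D (rcons w a) = word_mx U D w * letter_mx U D a.
Proof. by rewrite -cats1 word_mx_cat word_mx1. Qed.

Lemma word_mx_adj U D w : word_mx U D (word_adj w) = (word_mx U D w)^t*.
Proof.
elim: w => [|a w IH]; first by rewrite /word_mx big_nil adjmx1.
rewrite /word_adj/= rev_cons word_mx_rcons IH word_mx_cons adjmxM; congr (_ * _).
by rewrite /letter_mx/=; case: a.1 => //=; rewrite trmxCK.
Qed.

Lemma nconst_adj w : nconst (word_adj w) = nconst w.
Proof. by rewrite /nconst /word_adj count_rev count_map. Qed.

Lemma ntr_word_catC U D w z :
  ntr (word_mx U D (w ++ z)) = ntr (word_mx U D (z ++ w)).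
Proof. by rewrite !word_mx_cat ntrC. Qed.

Definition unitary_family (U : J -> M) := forall j, (U j)^t* * U j = 1.

Lemma unitary_letter U D a j : unitary_family U -> a.2 = inl j ->
  (letter_mx U D a)^t* * letter_mx U D a = 1 /\
  letter_mx U D a * (letter_mx U D a)^t* = 1.
Proof.
move=> Uu aj; have h := Uu j; have h' : U j * (U j)^t* = 1.
  exact: mulmx1C h.
by rewrite /letter_mx aj; case: a.1 => //; rewrite trmxCK.
Qed.

(** Every unitary letter is absorbed by the factor on its right. A final identity receives the
    trailing ones, which accounts for the one extra factor and hence for the strict inequality. *)
Lemma ntr_word_bound k b (U : J -> M) (D : I -> M) w : 1 <= b ->
  unitary_family U -> (forall i, power_bound k b (D i)) ->
  (nconst w < 2 ^ k.+1)%N -> `|ntr (word_mx U D w)| <= b.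
Proof.
move=> b1 Uu Db wk.
suff [L [sL bL <-]] : exists L : seq M, [/\ size L = (nconst w).+1,
    forall A, A \in L -> power_bound k b A & \prod_(A <- L) A = word_mx U D w].
  by apply: ntr_Hoelder b1 _ bL; rewrite sL.
elim: w {wk} => [|a w [L [sL bL eL]]].
  exists [:: 1]; split => //; last by rewrite word_mx_nil big_seq1.
  by move=> A; rewrite inE => /eqP->; exact: power_bound1.
case Ea : a.2 => [j|i].
  case: L sL bL eL => // A L sL bL eL.
  exists (letter_mx U D a * A :: L); split.
  - by rewrite -[LHS]/(size (A :: L)) sL /nconst/= /is_const Ea.
  - move=> B; rewrite inE => /predU1P[->|BL]; last by apply: bL; rewrite inE BL orbT.
    apply: power_bound_unitary; last by apply: bL; rewrite inE eqxx.
    exact: (unitary_letter D Uu Ea).1.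
  - by rewrite word_mx_cons -eL !big_cons mulrA.
exists (letter_mx U D a :: L); split.
- by rewrite /= sL /nconst/= /is_const Ea.
- move=> B; rewrite inE => /predU1P[->|/bL//].
  by rewrite /letter_mx Ea; case: a.1 => //; exact: power_bound_adj.
- by rewrite big_cons eL word_mx_cons.
Qed.

Definition bool_sign (e : bool) : C := (-1) ^+ ~~ e.

Definition word_der (U : J -> M) (D : I -> M) (j : J) (A : M) z w : M :=
  \sum_(t <- split_terms j z w)
    bool_sign t.1 *: (word_mx U D t.2.1 * A * word_mx U D t.2.2).

(** The minus sign is that of conj t = - t + O(t^2) on the circle |1 + t| = 1: for self-adjoint A
    the adjoint of (1 + t A) u_j is u_j^* (1 + conj t A). *)
Definition letter_der (U : J -> M) (j : J) (A : M) a : M :=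
  if a.2 is inl i then
    if i == j then (if a.1 then A * U i else - ((U i)^t* * A)) else 0
  else 0.

Lemma word_derE U D j A z w :
  word_der U D j A z w = word_mx U D z * word_der U D j A [::] w.
Proof.
elim: w z => [|a w IH] z; first by rewrite /word_der !big_nil mulr0.
have step z' : word_der U D j A z' (a :: w) =
    word_mx U D z' * (letter_der U j A a * word_mx U D w +
      letter_mx U D a * word_der U D j A [::] w).
  rewrite {1}/word_der /= big_cat/=.
  rewrite -[X in _ + X]/(word_der U D j A (rcons z' a) w) IH word_mx_rcons.
  rewrite mulrDr !mulrA; congr (_ + _).
  rewrite /letter_der; case: a => c [i|i]/=; last by rewrite big_nil mulr0 mul0r.
  case: eqP => [->|_]; last by rewrite big_nil mulr0 mul0r.
  rewrite big_seq1/=; case: c => /=.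
    by rewrite /bool_sign expr0 scale1r word_mx_cons /letter_mx/= !mulrA.
  by rewrite /bool_sign expr1 scaleN1r word_mx_rcons /letter_mx/= mulrN mulNr !mulrA.
by rewrite step [in RHS]step word_mx_nil mul1r.
Qed.

Lemma word_der_cons U D j A a w :
  word_der U D j A [::] (a :: w) =
    letter_der U j A a * word_mx U D w + letter_mx U D a * word_der U D j A [::] w.
Proof.
rewrite {1}/word_der /= big_cat/=.
rewrite -[X in _ + X]/(word_der U D j A [:: a] w) word_derE word_mx1.
congr (_ + _).
rewrite /letter_der; case: a => c [i|i]/=; last by rewrite big_nil mul0r.
case: eqP => [->|_]; last by rewrite big_nil mul0r.
rewrite big_seq1/=; case: c => /=.
  by rewrite /bool_sign expr0 scale1r word_mx_nil word_mx_cons /letter_mx/= mul1r mulrA.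
by rewrite /bool_sign expr1 scaleN1r word_mx1 /letter_mx/= mulNr.
Qed.

(** Summation over matrix units splits a word at the place where the unit was inserted; this
    produces the products of traces in the loop equation. *)
Lemma sum_delta_trace (X Y : M) :
  \sum_i \sum_j (X * delta_mx i j * Y) i j = \tr X * \tr Y.
Proof.
rewrite /mxtrace mulr_suml; apply: eq_bigr => i _; rewrite mulr_sumr.
apply: eq_bigr => j _; rewrite -!mulmxE mxE (bigD1 j)//= big1 ?addr0.
  rewrite mxE (bigD1 i)//= big1 ?addr0 ?mxE ?eqxx ?mulr1//.
  by move=> k /negPf ki; rewrite !mxE ki mulr0.
move=> k /negPf kj; rewrite mxE big1 ?mul0r// => l _.
by rewrite !mxE kj andbF mulr0.
Qed.

(** Here the same summation glues two words into one trace; this produces the remainder of the loop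
    equation. *)
Lemma sum_delta_trace2 (X Y Z : M) :
  \sum_i \sum_j Z i j * \tr (X * delta_mx i j * Y) = \tr (Z * Y * X).
Proof.
rewrite -mulrA -!mulmxE [in RHS]/mxtrace; apply: eq_bigr => i _; rewrite mxE.
apply: eq_bigr => j _; congr (_ * _).
rewrite -mulmxA mxtrace_mulC -mulmxA mulmxE -{1}[Y * X]mul1r /mxtrace.
rewrite (bigD1 i)//= big1 ?addr0.
  rewrite mul1r mxE (bigD1 j)//= big1 ?addr0 ?mxE ?eqxx ?mul1r//.
  by move=> k /negPf kj; rewrite !mxE kj andbF mul0r.
move=> k /negPf kj; rewrite mul1r mxE big1// => l _.
by rewrite !mxE kj mul0r.
Qed.

End Words.

(** * Loop equation *)

(* An integral Ex restricted to bounded measurable functions bm. *)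
Record expectation_form (C : numClosedFieldType) (Om : Type) := ExpectationForm {
  bm : (Om -> C) -> Prop;
  Ex : (Om -> C) -> C;
  bm_cst : forall c, bm (fun _ => c);
  bmD : forall f g, bm f -> bm g -> bm (fun w => f w + g w);
  bmM : forall f g, bm f -> bm g -> bm (fun w => f w * g w);
  bm_conj : forall f, bm f -> bm (fun w => (f w)^*);
  bm_bounded : forall f, bm f -> exists2 K : C, 0 <= K & forall w, `|f w| <= K;
  ExD : forall f g, bm f -> bm g -> Ex (fun w => f w + g w) = Ex f + Ex g;
  ExZ : forall c f, bm f -> Ex (fun w => c * f w) = c * Ex f;
  Ex_ge0 : forall f, bm f -> (forall w, 0 <= f w) -> 0 <= Ex f;
  Ex1 : Ex (fun _ => 1) = 1;
  Ex_ext : forall f g, f =1 g -> Ex f = Ex g;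
  bm_ext : forall f g, f =1 g -> bm f -> bm g
}.
Arguments bm {C Om}.
Arguments Ex {C Om}.

Section Expectation.
Variables (C : numClosedFieldType) (Om : Type) (E : expectation_form C Om).
Implicit Types f g : Om -> C.

Lemma bmZ c f : bm E f -> bm E (fun w => c * f w).
Proof. exact/bmM/bm_cst. Qed.

Lemma bmN f : bm E f -> bm E (fun w => - f w).
Proof. by move=> /(bmZ (-1)); apply: bm_ext => w; rewrite mulN1r. Qed.

Lemma bmB f g : bm E f -> bm E g -> bm E (fun w => f w - g w).
Proof. by move=> hf hg; apply: bmD => //; exact: bmN. Qed.

Lemma bm_sum (T : Type) (r : seq T) (F : T -> Om -> C) :
  (forall i, bm E (F i)) -> bm E (fun w => \sum_(i <- r) F i w).
Proof.
move=> hF; elim: r => [|i r IH].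
  by apply: bm_ext (bm_cst E 0) => w; rewrite big_nil.
by apply: bm_ext (bmD (hF i) IH) => w; rewrite big_cons.
Qed.

Lemma Ex_cst c : Ex E (fun _ => c) = c.
Proof.
rewrite -[RHS]mulr1 -(Ex1 E) -ExZ; last exact: bm_cst.
by apply: Ex_ext => w; rewrite mulr1.
Qed.

Lemma ExB f g : bm E f -> bm E g -> Ex E (fun w => f w - g w) = Ex E f - Ex E g.
Proof.
move=> hf hg; rewrite -[- Ex E g]mulN1r -ExZ// -ExD//; last exact: bmZ.
by apply: Ex_ext => w; rewrite mulN1r.
Qed.

Lemma Ex_sum (T : Type) (r : seq T) (F : T -> Om -> C) :
  (forall i, bm E (F i)) ->
  Ex E (fun w => \sum_(i <- r) F i w) = \sum_(i <- r) Ex E (F i).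
Proof.
move=> hF; elim: r => [|i r IH].
  rewrite big_nil -[RHS](Ex_cst 0).
  by apply: Ex_ext => w; rewrite big_nil.
rewrite big_cons -IH -ExD//; last exact: bm_sum.
by apply: Ex_ext => w; rewrite big_cons.
Qed.

Lemma le_Ex f g : bm E f -> bm E g -> (forall w, f w <= g w) -> Ex E f <= Ex E g.
Proof.
move=> hf hg fg; rewrite -subr_ge0 -ExB//; apply: Ex_ge0; first exact: bmB.
by move=> w; rewrite subr_ge0.
Qed.

Lemma Ex_real f : bm E f -> (forall w, f w \is Num.real) -> Ex E f \is Num.real.
Proof.
move=> hf fr; have [K K0 fK] := bm_bounded hf.
have h : 0 <= K + Ex E f.
  rewrite -(Ex_cst K) -ExD//; last exact: bm_cst.
  apply: Ex_ge0; first by apply: bmD => //; exact: bm_cst.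
  move=> w; have := fK w; rewrite real_ler_norml// => /andP[h _].
  by rewrite -[f w]opprK subr_ge0 -lerN2 opprK.
have -> : Ex E f = (K + Ex E f) - K by ring.
by apply: realB => //; exact: ger0_real.
Qed.

(** The factor 2 comes from treating real and imaginary parts separately. A majorant [g] appears
    because [bm] is not assumed to be closed under absolute values. *)
Lemma norm_Ex f g : bm E f -> bm E g -> (forall w, `|f w| <= g w) ->
  `|Ex E f| <= 2 * Ex E g.
Proof.
move=> hf hg fg.
have hRe : bm E (fun w => 'Re (f w)).
  have := bmZ (2^-1) (bmD hf (bm_conj hf)).
  by apply: bm_ext => w; rewrite ReE mulrC.
have hIm : bm E (fun w => 'Im (f w)).
  have := bmZ (2^-1 * 'i) (bmB (bm_conj hf) hf).
  by apply: bm_ext => w; rewrite ImE; ring.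
have -> : Ex E f = Ex E (fun w => 'Re (f w)) + 'i * Ex E (fun w => 'Im (f w)).
  rewrite -ExZ// -ExD//; last exact: bmZ.
  by apply: Ex_ext => w; rewrite -Crect.
have dominated h : bm E h -> (forall w, h w \is Num.real) ->
    (forall w, `|h w| <= g w) -> `|Ex E h| <= Ex E g.
  move=> bh hr hle; rewrite real_ler_norml ?Ex_real//; apply/andP; split.
    rewrite -subr_ge0 opprK addrC -ExD//; apply: Ex_ge0; first exact: bmD.
    move=> w; have := hle w; rewrite real_ler_norml// => /andP[h1 _].
    by rewrite -[h w]opprK subr_ge0 -lerN2 opprK.
  by apply: le_Ex => // w; have := hle w; rewrite real_ler_norml// => /andP[].
apply: le_trans (ler_normD _ _) _; rewrite normrM normCi mul1r mulr_natl mulr2n.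
apply: lerD; apply: dominated => //.
- move=> w; apply: le_trans (fg w); rewrite -(@ler_pXn2r _ 2) ?nnegrE//.
  by rewrite (normC2_Re_Im (f w)) real_normK ?Creal_Re// lerDl
    real_exprn_even_ge0// Creal_Im.
- move=> w; apply: le_trans (fg w); rewrite -(@ler_pXn2r _ 2) ?nnegrE//.
  by rewrite (normC2_Re_Im (f w)) real_normK ?Creal_Im// lerDr
    real_exprn_even_ge0// Creal_Re.
Qed.

End Expectation.

(** * First order expansions along the circle |1 + t| = 1 *)

Section FirstOrderExpansion.
Variables (C : numClosedFieldType) (Om : Type) (E : expectation_form C Om).
Implicit Types (F G : C -> Om -> C) (f g : Om -> C).

(** The quadratic remainder is uniform in the sample point, so it survives integration. It is
    required only on the circle |1 + t| = 1, where 1 + tQ is unitary for every projection Q. *)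
Definition expands F f f' := [/\ bm E f, bm E f', forall t, bm E (F t) &
  exists2 K : C, 0 <= K & forall t w, `|1 + t| = 1 ->
    `|F t w - f w - t * f' w| <= K * `|t| ^+ 2].

Lemma norm_le2 (t : C) : `|1 + t| = 1 -> `|t| <= 2.
Proof.
move=> t1; have -> : t = (1 + t) - 1 by ring.
by apply: le_trans (ler_normB _ _) _; rewrite t1 normr1.
Qed.

Lemma expands_exact F f f' : bm E f -> bm E f' ->
  (forall t w, F t w = f w + t * f' w) -> expands F f f'.
Proof.
move=> hf hf' h; split => //.
  by move=> t; apply: bm_ext (bmD hf (bmZ t hf')) => w; rewrite h.
exists 0 => // t w _; rewrite h.
by rewrite (_ : _ - _ - _ = 0) ?normr0 ?mul0r//; ring.
Qed.

Lemma expands_ext F f f' G g g' : (forall t, F t =1 G t) -> f =1 g -> f' =1 g' ->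
  expands F f f' -> expands G g g'.
Proof.
move=> FG fg fg' [hf hf' hF [K K0 FK]]; split.
- exact: bm_ext hf.
- exact: bm_ext hf'.
- by move=> t; exact: bm_ext (hF t).
- by exists K => // t w t1; rewrite -FG -fg -fg'; exact: FK.
Qed.

Lemma expands_cst c : expands (fun _ _ => c) (fun _ => c) (fun _ => 0).
Proof.
apply: expands_exact; try exact: bm_cst.
by move=> t w; rewrite mulr0 addr0.
Qed.

Lemma expandsM F f f' G g g' : expands F f f' -> expands G g g' ->
  expands (fun t w => F t w * G t w) (fun w => f w * g w)
    (fun w => f' w * g w + f w * g' w).
Proof.
move=> [hf hf' hF [K K0 FK]] [hg hg' hG [L L0 GL]].
split; [exact: bmM|by apply: bmD; exact: bmM|by move=> t; exact: bmM|].
have [a a0 ha] := bm_bounded hf; have [a' a'0 ha'] := bm_bounded hf'.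
have [b b0 hb] := bm_bounded hg; have [b' b'0 hb'] := bm_bounded hg'.
(* The three summands bound the three parts into which the error is decomposed below, using |t| <= 2
   on the circle. *)
exists (a' * b' + K * (b + 2 * b' + L * 2 ^+ 2) + (a + 2 * a') * L).
  by rewrite !addr_ge0 ?mulr_ge0 ?addr_ge0 ?mulr_ge0 ?exprn_ge0.
move=> t w t1; set r := F t w - f w - t * f' w; set s := G t w - g w - t * g' w.
have -> : F t w * G t w - f w * g w - t * (f' w * g w + f w * g' w) =
    t ^+ 2 * (f' w * g' w) + r * (g w + t * g' w + s) + (f w + t * f' w) * s.
  by rewrite /r /s; ring.
have t2 := norm_le2 t1.
have hr : `|r| <= K * `|t| ^+ 2 by exact: FK.
have hs : `|s| <= L * `|t| ^+ 2 by exact: GL.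
have ht2 : `|t| ^+ 2 <= 2 ^+ 2 by rewrite lerXn2r ?nnegrE.
have nadd (x y u v : C) : `|x| <= u -> `|y| <= v -> `|x + y| <= u + v.
  by move=> h1 h2; apply: le_trans (ler_normD _ _) (lerD h1 h2).
have nmul (x y u v : C) : `|x| <= u -> `|y| <= v -> `|x * y| <= u * v.
  by move=> h1 h2; rewrite normrM ler_pM.
rewrite [X in _ <= X]mulrDl [X in _ <= X + _]mulrDl; apply: (nadd); first apply: (nadd).
- rewrite [t ^+ 2 * _]mulrC; apply: (nmul); last by rewrite normrX.
  exact: (nmul).
- rewrite -mulrA [_ * `|t| ^+ 2]mulrC mulrA; apply: (nmul) => //.
  apply: (nadd); first by apply: (nadd) => //; exact: (nmul).
  by apply: le_trans hs _; exact: ler_wpM2l.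
- by rewrite -mulrA; apply: (nmul) => //; apply: (nadd) => //; exact: (nmul).
Qed.

Lemma expands_sum (T : Type) (r : seq T) (F : T -> C -> Om -> C)
    (f f' : T -> Om -> C) :
  (forall i, expands (F i) (f i) (f' i)) ->
  expands (fun t w => \sum_(i <- r) F i t w) (fun w => \sum_(i <- r) f i w)
    (fun w => \sum_(i <- r) f' i w).
Proof.
move=> h; have [hf hf' hF _] : [/\ forall i, bm E (f i), forall i, bm E (f' i),
  forall i t, bm E (F i t) & True] by split => // i; case: (h i).
split; [exact: bm_sum|exact: bm_sum|by move=> t; exact: bm_sum|].
elim: r => [|i r [K K0 HK]].
  by exists 0 => // t w _; rewrite !big_nil mulr0 !subr0 normr0 mul0r.
have [_ _ _ [L L0 HL]] := h i; exists (L + K); first exact: addr_ge0.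
move=> t w t1; rewrite !big_cons.
have -> : F i t w + \sum_(j <- r) F j t w - (f i w + \sum_(j <- r) f j w) -
   t * (f' i w + \sum_(j <- r) f' j w) = (F i t w - f i w - t * f' i w) +
   (\sum_(j <- r) F j t w - \sum_(j <- r) f j w - t * (\sum_(j <- r) f' j w)) by ring.
by rewrite mulrDl; apply: le_trans (ler_normD _ _) _; apply: lerD; auto.
Qed.

(* The points (1 + ix)/(1 - ix) of the unit circle accumulate at 1. *)
Lemma unit_circle_near1 (x : C) : 0 < x ->
  exists t : C, [/\ t != 0, `|1 + t| = 1 & `|t| <= 2 * x].
Proof.
move=> x0; have xr : x \is Num.real by exact: gtr0_real.
have nD : `|1 - 'i * x| ^+ 2 = 1 + x ^+ 2.
  by rewrite -mulrN normC2_rect ?realN ?rpred1// expr1n sqrrN.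
have d0 : 1 - 'i * x != 0.
  by rewrite -normr_eq0 -sqrf_eq0 nD gt_eqF// addr_gt0// exprn_gt0.
exists (2 * 'i * x / (1 - 'i * x)); split.
- by rewrite mulf_neq0 ?invr_eq0// !mulf_neq0 ?pnatr_eq0 ?neq0Ci// gt_eqF.
- have -> : 1 + 2 * 'i * x / (1 - 'i * x) = (1 + 'i * x) / (1 - 'i * x) by field.
  have -> : `|(1 + 'i * x) / (1 - 'i * x)| = `|1 + 'i * x| / `|1 - 'i * x|.
    exact: normf_div.
  have -> : `|1 + 'i * x| = `|1 - 'i * x|.
    apply/eqP; rewrite -(@eqrXn2 _ 2)// nD.
    by rewrite normC2_rect ?rpred1// expr1n.
  by rewrite divff// normr_eq0.
- rewrite normf_div !normrM normCi mulr1 normr_nat (gtr0_norm x0).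
  rewrite ler_pdivrMr ?normr_gt0// ler_peMr// ?mulr_ge0 ?(ltW x0)//.
  by rewrite -(@ler_pXn2r _ 2) ?nnegrE// nD expr1n lerDl exprn_ge0// ltW.
Qed.

(** Integrating the expansion and dividing by t gives |E f'| <= 2 K |t|, and the circle has points
    with t arbitrarily small and nonzero. *)
Lemma expands_Ex_eq0 F f f' : expands F f f' ->
  (forall t, `|1 + t| = 1 -> Ex E (F t) = Ex E f) -> Ex E f' = 0.
Proof.
move=> [hf hf' hF [K K0 FK]] Einv.
have key t : t != 0 -> `|1 + t| = 1 -> `|Ex E f'| <= 2 * K * `|t|.
  move=> t0 t1; have h := norm_Ex (bmB (bmB (hF t) hf) (bmZ t hf')) (bm_cst E _)
    (fun w => FK t w t1).
  move: h; rewrite Ex_cst !ExB//; [|exact: bmB|exact: bmZ].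
  rewrite ExZ// Einv// subrr sub0r normrN normrM mulrA expr2 mulrA mulrC.
  by rewrite ler_pM2r// normr_gt0.
apply/eqP; apply: contraT; rewrite -normr_gt0 => e0.
(* With |t| <= 2x and x = |E f'| / (8 (K + 1)), the bound 2 K |t| is at most |E f'| K / (2 (K + 1))
   < |E f'|. The [+ 1] keeps the denominator positive when K = 0. *)
have L0 : 0 < 8 * (K + 1) by rewrite mulr_gt0// ltr_wpDl.
have [t [t0 t1 tx]] := unit_circle_near1 (divr_gt0 e0 L0).
suff /(le_lt_trans (key t t0 t1)) : 2 * K * `|t| < `|Ex E f'| by rewrite ltxx.
apply: le_lt_trans (_ : 2 * K * (2 * (`|Ex E f'| / (8 * (K + 1)))) < _).
  by apply: ler_wpM2l => //; rewrite mulr_ge0.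
have -> : 2 * K * (2 * (`|Ex E f'| / (8 * (K + 1)))) =
    `|Ex E f'| * (K / (2 * (K + 1))).
  by field; rewrite gt_eqF// ltr_wpDl.
rewrite -[X in _ < X]mulr1 ltr_pM2l// ltr_pdivrMr ?mulr_gt0 ?ltr_wpDl//.
by rewrite mul1r mulrDr mulr1 mulr_natl mulr2n -addrA ltrDl ltr_wpDl.
Qed.

End FirstOrderExpansion.

(** * Vanishing derivatives from invariance *)

Section SchwingerDyson.
Variables (C : numClosedFieldType) (n : nat) (J : eqType) (I Om : Type).
Local Notation M := 'M[C]_n.+1.
Variables (E : expectation_form C Om) (U : Om -> J -> M) (D : I -> M).
Local Notation letter := (letter J I).
Implicit Types (X Y : seq letter) (Q A V : M).

Definition translate (u : J -> M) (j : J) (V : M) (i : J) : M :=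
  if i == j then V * u i else u i.

Definition bm_family (u : Om -> J -> M) :=
  forall i a b, bm E (fun w => u w i a b).

(** Invariance is recorded only for the test functions of the loop equation: an entry of one word
    times the trace of another. A single u_j is translated, so for random matrices this expresses
    independence as well as the Haar property. *)
Definition left_invariant := forall j (V : M), V * V^t* = 1 ->
  forall X Y a b,
  Ex E (fun w => word_mx (translate (U w) j V) D X a b *
                 ntr (word_mx (translate (U w) j V) D Y)) =
  Ex E (fun w => word_mx (U w) D X a b * ntr (word_mx (U w) D Y)).

Lemma bm_letter (u : Om -> J -> M) (a : letter) i k : bm_family u ->
  bm E (fun w => letter_mx (u w) D a i k).
Proof.
move=> hu; rewrite /letter_mx; case: a => [[] [j|x]] /=.
- exact: hu.
- exact: bm_cst.
- by apply: bm_ext (bm_conj (hu j k i)) => w; rewrite !mxE.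
- exact: bm_cst.
Qed.

Lemma bm_word (u : Om -> J -> M) (x : seq letter) i k : bm_family u ->
  bm E (fun w => word_mx (u w) D x i k).
Proof.
move=> hu; elim: x i k => [|a x IH] i k.
  by apply: bm_ext (bm_cst E ((1 : M) i k)) => w; rewrite word_mx_nil.
have h : bm E (fun w => \sum_l letter_mx (u w) D a i l * word_mx (u w) D x l k).
  by apply: bm_sum => l; apply: bmM (bm_letter _ _ _ hu) (IH _ _).
by apply: bm_ext h => w; rewrite word_mx_cons -mulmxE mxE.
Qed.

Lemma bm_ntr_word (u : Om -> J -> M) (x : seq letter) : bm_family u ->
  bm E (fun w => ntr (word_mx (u w) D x)).
Proof.
move=> hu; have h := bmM (bm_sum (index_enum 'I_n.+1)
  (fun i => bm_word x i i hu)) (bm_cst E (n.+1%:R^-1)).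
exact: bm_ext h.
Qed.

Hypothesis bmU : bm_family U.

Lemma bm_word_der j A (x : seq letter) i k :
  bm E (fun w => word_der (U w) D j A [::] x i k).
Proof.
have h : bm E (fun w => \sum_(t <- split_terms j [::] x) bool_sign C t.1 *
   \sum_l (\sum_m word_mx (U w) D t.2.1 i m * A m l) * word_mx (U w) D t.2.2 l k).
  apply: bm_sum => t; apply: bmZ; apply: bm_sum => l.
  apply: bmM; last exact: bm_word.
  by apply: bm_sum => m; apply: bmM; [exact: bm_word|exact: bm_cst].
apply: bm_ext h => w; rewrite /word_der summxE; apply: eq_bigr => t _.
rewrite [in RHS]mxE -mulmxE [in RHS]mxE; congr (_ * _); apply: eq_bigr => l _.
by rewrite mxE.
Qed.

Lemma bm_ntr_word_der j A (x : seq letter) :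
  bm E (fun w => ntr (word_der (U w) D j A [::] x)).
Proof.
have h := bmM (bm_sum (index_enum 'I_n.+1)
  (fun i => bm_word_der j A x i i)) (bm_cst E (n.+1%:R^-1)).
exact: bm_ext h.
Qed.

Lemma bm_mul_const A j i k : bm E (fun w => (A * U w j) i k).
Proof.
have h : bm E (fun w => \sum_l A i l * U w j l k).
  by apply: bm_sum => l; apply: bmM; [exact: bm_cst|exact: bmU].
by apply: bm_ext h => w; rewrite -mulmxE mxE.
Qed.

(* On the unit circle |1 + t| = 1 one has conj t = - t - |t|^2, so the adjoint
   letters also have a first order expansion in t. *)
Lemma expands_letter j Q (a : letter) i k : Q^t* = Q ->
  expands E (fun t w => letter_mx (translate (U w) j (1 + t *: Q)) D a i k)
    (fun w => letter_mx (U w) D a i k)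
    (fun w => letter_der (U w) j Q a i k).
Proof.
move=> Qh; case: a => c [l|x]; last first.
  apply: expands_ext (expands_cst E (letter_mx (fun _ : J => 0) D (c, inr x) i k)) => //.
  by move=> w; rewrite /letter_der/= mxE.
rewrite /letter_der /letter_mx /translate/=; case: eqP => [->|_]; last first.
  have h : bm E (fun w => letter_mx (U w) D (c, inl l) i k) by exact: bm_letter.
  apply: expands_exact => //; first by apply: bm_ext (bm_cst E 0) => w; rewrite mxE.
  by move=> t w; rewrite mxE mulr0 addr0.
case: c.
  apply: expands_exact; [exact: bmU|exact: bm_mul_const|].
  by move=> t w; rewrite mulrDl mul1r mxE -scalerAl mxE.
have hQ : bm E (fun w => ((U w j)^t* * Q) i k).
  apply: bm_ext (bm_conj (bm_mul_const Q j k i)) => w.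
  by rewrite -[in RHS]Qh -adjmxM !mxE.
have ht t w : ((1 + t *: Q) * U w j)^t* i k =
    (U w j)^t* i k + t^* * ((U w j)^t* * Q) i k.
  rewrite mulrDl mul1r -scalerAl -[in RHS]Qh -adjmxM !mxE.
  by rewrite rmorphD rmorphM.
have bmUc : bm E (fun w => ((U w j)^t*) i k).
  by apply: bm_ext (bm_conj (bmU j k i)) => w; rewrite !mxE.
have [K K0 HK] := bm_bounded hQ.
split => //.
- by apply: bm_ext (bmN hQ) => w; rewrite [in RHS]mxE.
- by move=> t; apply: bm_ext (bmD bmUc (bmZ t^* hQ)) => w; rewrite ht.
exists K => // t w t1; rewrite ht.
have tc : t^* = - t - `|t| ^+ 2.
  have : `|1 + t| ^+ 2 = 1 by rewrite t1 expr1n.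
  rewrite !normCK rmorphD rmorph1 => h.
  have {1}-> : t^* = (1 + t) * (1 + t^*) - 1 - t - t * t^* by ring.
  by rewrite h; ring.
rewrite [(- _ : M) i k]mxE tc.
have -> : (U w j)^t* i k + (- t - `|t| ^+ 2) * ((U w j)^t* * Q) i k -
   (U w j)^t* i k - t * - ((U w j)^t* * Q) i k =
   - (((U w j)^t* * Q) i k * `|t| ^+ 2) by ring.
by rewrite normrN normrM normrX normr_id ler_wpM2r ?exprn_ge0.
Qed.

Lemma expands_word j Q (x : seq letter) i k : Q^t* = Q ->
  expands E (fun t w => word_mx (translate (U w) j (1 + t *: Q)) D x i k)
    (fun w => word_mx (U w) D x i k)
    (fun w => word_der (U w) D j Q [::] x i k).
Proof.
move=> Qh; elim: x i k => [|a x IH] i k.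
  apply: expands_ext (expands_cst E ((1 : M) i k)).
  - by move=> t w; rewrite word_mx_nil.
  - by move=> w; rewrite word_mx_nil.
  - by move=> w; rewrite /word_der big_nil mxE.
apply: expands_ext (expands_sum (index_enum 'I_n.+1)
  (fun l => expandsM (expands_letter j a i l Qh) (IH l k))).
- by move=> t w; rewrite word_mx_cons -mulmxE mxE.
- by move=> w; rewrite word_mx_cons -mulmxE mxE.
- by move=> w; rewrite word_der_cons big_split/= -!mulmxE 3!mxE.
Qed.

Lemma expands_ntr_word j Q (x : seq letter) : Q^t* = Q ->
  expands E (fun t w => ntr (word_mx (translate (U w) j (1 + t *: Q)) D x))
    (fun w => ntr (word_mx (U w) D x))
    (fun w => ntr (word_der (U w) D j Q [::] x)).
Proof.
move=> Qh; apply: expands_ext (expandsM (expands_sum (index_enum 'I_n.+1)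
  (fun l => expands_word j x l l Qh)) (expands_cst E n.+1%:R^-1)) => //.
by move=> w; rewrite mulr0 addr0.
Qed.

Definition pair_der j A X Y i k w :=
  word_der (U w) D j A [::] X i k * ntr (word_mx (U w) D Y) +
  word_mx (U w) D X i k * ntr (word_der (U w) D j A [::] Y).

Hypothesis invU : left_invariant.

(** The coefficient of Q in (1 + tQ)(1 + tQ)^* - 1 is t + conj t + |t|^2, which is zero exactly when
    |1 + t| = 1. So these translations are unitary and leave the expectation constant. *)
Lemma Ex_pair_der_proj j Q X Y i k : Q^t* = Q -> Q * Q = Q ->
  Ex E (pair_der j Q X Y i k) = 0.
Proof.
move=> Qh QQ; apply: expands_Ex_eq0
  (expandsM (expands_word j X i k Qh) (expands_ntr_word j Y Qh)) _.
move=> t t1; apply: invU.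
have tc : t^* = - t - t * t^*.
  have : `|1 + t| ^+ 2 = 1 by rewrite t1 expr1n.
  rewrite normCK rmorphD rmorph1 => h.
  have {1}-> : t^* = (1 + t) * (1 + t^*) - 1 - t - t * t^* by ring.
  by rewrite h; ring.
have -> : (1 + t *: Q)^t* = 1 + t^* *: Q.
  rewrite -[in RHS]Qh; apply/matrixP => a b; rewrite !mxE rmorphD rmorphM/=.
  by rewrite rmorph_nat eq_sym.
rewrite mulrDl mul1r mulrDr mulr1 -scalerAr -scalerAl QQ scalerA.
rewrite -addrA -!scalerDl (_ : t^* + (t + t^* * t) = 0) ?scale0r ?addr0//.
by rewrite {1}tc; ring.
Qed.

Lemma word_der_lin (u : J -> M) j c A A' (x : seq letter) :
  word_der u D j (c *: A + A') [::] x =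
  c *: word_der u D j A [::] x + word_der u D j A' [::] x.
Proof.
rewrite /word_der scaler_sumr -big_split/=; apply: eq_bigr => t _.
rewrite mulrDr mulrDl scalerDr -scalerAr -scalerAl !scalerA.
by rewrite mulrC.
Qed.

Lemma ntr_lin c A A' : ntr (c *: A + A') = c * ntr A + ntr A'.
Proof. by rewrite /ntr linearP/= mulrDl mulrA. Qed.

Lemma bm_pair_der j A X Y i k : bm E (pair_der j A X Y i k).
Proof.
apply: bmD; apply: bmM.
- exact: bm_word_der.
- exact: bm_ntr_word.
- exact: bm_word.
- exact: bm_ntr_word_der.
Qed.

Lemma Ex_pair_der_lin j c A A' X Y i k :
  Ex E (pair_der j (c *: A + A') X Y i k) =
  c * Ex E (pair_der j A X Y i k) + Ex E (pair_der j A' X Y i k).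
Proof.
rewrite -ExZ -?ExD; try apply: bmZ; try exact: bm_pair_der.
apply: Ex_ext => w; rewrite /pair_der !word_der_lin ntr_lin 2!mxE.
ring.
Qed.

(* Polarization: L(Q) = 0 for the rank one projections Q onto the lines spanned
   by e_a and e_a + z e_c with |z| = 1 forces the linear form L to vanish. *)
Lemma Ex_pair_der_delta j X Y i k a c :
  Ex E (pair_der j (delta_mx a c) X Y i k) = 0.
Proof.
pose L A := Ex E (pair_der j A X Y i k).
have Llin z A A' : L (z *: A + A') = z * L A + L A' by exact: Ex_pair_der_lin.
have dd (p q r s : 'I_n.+1) : (delta_mx p q : M) * delta_mx r s =
    delta_mx p s *+ (q == r) by rewrite -mulmxE mul_delta_mx_cond.
have dh (p q : 'I_n.+1) : (delta_mx p q : M)^t* = delta_mx q p.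
  by apply/matrixP => x y; rewrite !mxE rmorph_nat andbC.
have Ldiag p : L (delta_mx p p) = 0.
  by apply: Ex_pair_der_proj; rewrite ?dh ?dd ?eqxx.
have [->|ac] := eqVneq a c; first exact: Ldiag.
have ca : (c == a) = false by apply/negbTE; rewrite eq_sym.
have key (z : C) : z * z^* = 1 -> z * L (delta_mx a c) + z^* * L (delta_mx c a) = 0.
  move=> zz.
  pose N : M := z *: delta_mx a c + (z^* *: delta_mx c a +
     (delta_mx a a + delta_mx c c)).
  have L0 : L 0 = 0.
    by have := Llin (-1) 0 0; rewrite scaler0 addr0 mulN1r addNr.
  have Nh : N^t* = N.
    apply/matrixP => x y; rewrite !mxE !(rmorphM, rmorphD)/= !rmorph_nat conjCK.
    rewrite [(y == a) && (x == c)]andbC [(y == c) && (x == a)]andbC.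
    rewrite [(y == a) && (x == a)]andbC [(y == c) && (x == c)]andbC; ring.
  have NN : N * N = 2%:R *: N.
    rewrite /N !(mulrDl, mulrDr) -!(scalerAl, scalerAr) !dd !eqxx ca (negPf ac).
    rewrite !mulr0n !mulr1n !scaler0 !scalerA [z^* * z]mulrC zz !scale1r.
    by apply/matrixP => x y; rewrite !mxE; ring.
  have : L (2^-1 *: N + 0) = 0.
    apply: Ex_pair_der_proj; rewrite addr0.
      apply/matrixP => x y; rewrite -[in RHS]Nh !mxE rmorphM/=.
      by rewrite fmorphV rmorph_nat.
    by rewrite -scalerAl -scalerAr NN !scalerA; congr (_ *: _); field.
  rewrite Llin L0 addr0 /N -[delta_mx a a]scale1r -[delta_mx c c]addr0.
  rewrite -[delta_mx c c]scale1r !Llin L0 !Ldiag !mulr0 !addr0 => /eqP.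
  by rewrite mulf_eq0 invr_eq0 pnatr_eq0/= => /eqP.
(* z = 1 makes the two off-diagonal values opposite and z = i makes them equal, so both vanish. *)
have h1 : L (delta_mx a c) = - L (delta_mx c a).
  have := key 1; rewrite rmorph1 !mul1r => /(_ erefl)/eqP.
  by rewrite addr_eq0 => /eqP.
have := key 'i; rewrite conjCi mulrN -expr2 sqrCi opprK => /(_ erefl).
rewrite -/(L _) h1 mulNr mulrN -opprD -mulr2n => /eqP.
by rewrite oppr_eq0 mulrn_eq0 mulf_eq0 (negPf (neq0Ci _))/= => /eqP->; rewrite oppr0.
Qed.

End SchwingerDyson.

(** * Combinatorics of the terms of the loop equation *)

Section SplitTerms.
Variables (C : numClosedFieldType) (J I : eqType).
Local Notation letter := (letter J I).
Implicit Types (x y z p : seq letter) (a : letter) (j : J).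

Lemma size_split_terms j z x : (size (split_terms j z x) <= size x)%N.
Proof.
elim: x z => [//|[c [i|i]] x IH] z /=; last exact: leqW.
by case: eqP => _ /=; [rewrite ltnS|apply: leqW].
Qed.

Lemma split_terms_nconst j z x t : t \in split_terms j z x ->
  (nconst t.2.1 + nconst t.2.2 = nconst z + nconst x)%N.
Proof.
elim: x z => [//|[c [i|i]] x IH] z /=; last first.
  by move=> /IH; rewrite /nconst -cats1 count_cat /=; lia.
have Etail : t \in split_terms j (rcons z (c, inl i)) x ->
    (nconst t.2.1 + nconst t.2.2 = nconst z + nconst ((c, inl i) :: x))%N.
  by move=> /IH; rewrite /nconst -cats1 count_cat /=; lia.
case: eqP => _ //; rewrite /= inE => /predU1P[->|//].
by case: c {Etail} => /=; rewrite /nconst -?cats1 ?count_cat/=; lia.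
Qed.

Lemma split_terms_const j p z : all (@is_const J I) z -> split_terms j p z = [::].
Proof. by elim: z p => [//|[c [i|i]] z IH] p //= /IH. Qed.

Lemma split_terms_cat j p x y :
  split_terms j p (x ++ y) =
  [seq (t.1, (t.2.1, t.2.2 ++ y)) | t <- split_terms j p x] ++
  split_terms j (p ++ x) y.
Proof.
elim: x p => [|a x IH] p /=; first by rewrite cats0.
rewrite IH cat_rcons map_cat -catA; congr (_ ++ _).
by case: a.2 => // i; case: eqP => //= _; case: a.1.
Qed.

(* Up to a cyclic permutation or a cancellation of u_j with u_j^*, the first
   factor of a term is p' or a :: p' for a proper prefix p' of p ++ y. *)
Lemma split_terms_shorter s j p y z t : let a := (s, inl j) in
  reduced (a :: p ++ y) -> all (@is_const J I) z ->
  t \in split_terms j (if s then a :: p else p) (y ++ z) ->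
  exists x, [/\ reduced x, (0 < size x <= size (p ++ y))%N,
    (nconst x <= nconst (p ++ y))%N &
    forall n (U : J -> 'M[C]_n.+1) (D : I -> 'M[C]_n.+1), unitary_family U ->
      ntr (word_mx U D t.2.1) = ntr (word_mx U D x)].
Proof.
move=> a + zc.
elim: y p => [|c y IH] p red /=.
  by rewrite split_terms_const.
rewrite mem_cat => /orP[|tin]; last first.
  have := IH (rcons p c); rewrite cat_rcons; apply=> //.
  by move: tin; case: s @a {IH red} => //=.
case Ec : c.2 => [i|//]; case: eqP => // ij; rewrite inE => /eqP -> /=.
have redap : reduced (a :: p).
  by move: red; rewrite /reduced -cat_cons => /cat_sorted2[].
have redp : reduced p by move: redap; rewrite /reduced/= => /path_sorted.
(* If [p] were empty, [c] would directly follow its inverse [a], against reducedness. This keeps the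
   empty word, whose trace is 1, out of the induction. *)
have p_neq0 : c.1 != s -> (0 < size p)%N.
  case: p red {redap redp} => [|//]; rewrite /reduced/= /compatible Ec /= ij eqxx/=.
  by rewrite eq_sym => /andP[->].
have sp : (size p < size (p ++ c :: y))%N by rewrite size_cat /= addnS ltnS leq_addr.
have np : (nconst p <= nconst (p ++ c :: y))%N by rewrite /nconst count_cat leq_addr.
have ce : c = (c.1, inl j) by rewrite -ij -Ec; case: (c).
have [cs|cs] := eqVneq c.1 s.
  exists (a :: p); split => //.
  move=> n U D _; rewrite cs; have -> : c = a by rewrite ce cs.
  by case: (s) => //=; rewrite -cats1 ntr_word_catC.
exists p; split => //; first by rewrite p_neq0//= ltnW.
case: s @a redap cs ce {IH red p_neq0} => a redap; case: c.1 => //= _ ce n U D Uu.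
have /= [h h'] := unitary_letter D Uu (erefl : a.2 = inl j).
rewrite -rcons_cons word_mx_rcons ntrC ce word_mx_cons mulrA.
have -> : letter_mx U D (false, inl j) = (letter_mx U D a)^t* by [].
by rewrite h mul1r.
Qed.
End SplitTerms.

Section LoopEquation.
Variables (C : numClosedFieldType) (n : nat) (J I : eqType) (Om : Type).
Local Notation M := 'M[C]_n.+1.
Variables (E : expectation_form C Om) (U : Om -> J -> M) (D : I -> M).
Local Notation letter := (letter J I).
Implicit Types (x y z X Y : seq letter).
Hypotheses (bmU : bm_family E U) (invU : left_invariant E U D).
Local Notation tr w x := (ntr (word_mx (U w) D x)).

Lemma mxtrace_ntr (A : M) : \tr A = n.+1%:R * ntr A.
Proof. by rewrite /ntr mulrC divfK// pnatr_eq0. Qed.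

(** The vanishing derivatives in the directions e_ik, each taken at entry (i, k) of X, are summed
    over i and k. Differentiating X gives two unnormalized traces, that is n^2 times normalized ones
    for size n; differentiating the normalized trace of Y gives weight 1. The quotient is the factor
    n^-2. *)
Lemma loop_equation j X Y :
  Ex E (fun w => \sum_(t <- split_terms j [::] X)
    bool_sign C t.1 * (tr w t.2.1 * tr w t.2.2 * tr w Y)) =
  - (n.+1%:R ^- 2 * Ex E (fun w => \sum_(t <- split_terms j [::] Y)
    bool_sign C t.1 * tr w (X ++ t.2.2 ++ t.2.1))).
Proof.
set f := fun w => _; set g := fun w => \sum_(t <- split_terms j [::] Y) _.
have bf : bm E f.
  apply: bm_sum => t; apply: bmZ; apply: bmM; last exact: bm_ntr_word.
  by apply: bmM; exact: bm_ntr_word.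
have bg : bm E g by apply: bm_sum => t; apply: bmZ; exact: bm_ntr_word.
have n0 : n.+1%:R != 0 :> C by rewrite pnatr_eq0.
suff : n.+1%:R ^+ 2 * Ex E f + Ex E g = 0.
  by move=> /addr0_eq <-; rewrite mulrN opprK mulrA mulVf ?mul1r// expf_neq0.
rewrite -ExZ// -ExD//; last exact: bmZ.
transitivity (Ex E (fun w => \sum_(i <- index_enum 'I_n.+1)
    \sum_(k <- index_enum 'I_n.+1) pair_der U D j (delta_mx i k) X Y i k w)).
  apply: Ex_ext => w; under eq_bigr do rewrite big_split/=.
  rewrite big_split/=; congr (_ + _).
    rewrite /f mulr_sumr /word_der.
    under [RHS]eq_bigr do under eq_bigr do rewrite summxE mulr_suml.
    under [RHS]eq_bigr do rewrite exchange_big/=.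
    rewrite exchange_big/=; apply: eq_bigr => t _.
    under [RHS]eq_bigr do under eq_bigr do rewrite mxE -mulrA.
    under [RHS]eq_bigr do rewrite -mulr_sumr -mulr_suml.
    rewrite -mulr_sumr -mulr_suml sum_delta_trace !mxtrace_ntr.
    by ring.
  rewrite /g /word_der.
  under [RHS]eq_bigr do under eq_bigr do rewrite /ntr raddf_sum/= mulr_suml mulr_sumr.
  under [RHS]eq_bigr do rewrite exchange_big/=.
  rewrite exchange_big/=; apply: eq_bigr => t _.
  rewrite catA !word_mx_cat /ntr -sum_delta_trace2 mulrA mulr_sumr mulr_suml.
  apply: eq_bigr => i _; rewrite mulr_sumr mulr_suml; apply: eq_bigr => k _.
  by rewrite mxtraceZ; ring.
rewrite Ex_sum; last by move=> i; apply: bm_sum => k; exact: bm_pair_der.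
rewrite big1// => i _; rewrite Ex_sum; last by move=> k; exact: bm_pair_der.
by rewrite big1// => k _; exact: Ex_pair_der_delta.
Qed.

End LoopEquation.

(** * Induction on reduced words *)

Section Induction.
Variables (C : numClosedFieldType) (J I : eqType) (b : C) (q k : nat).
(** A word has at most [q] constants; gluing it to pieces of its adjoint gives at most [2 * q],
    which must still be within reach of [ntr_word_bound]. *)
Hypotheses (b1 : 1 <= b) (qk : (2 * q < 2 ^ k.+1)%N).
Local Notation letter := (letter J I).
Implicit Types (x y z : seq letter).

Definition centered_system (Om : Type) n (E : expectation_form C Om)
    (U : Om -> J -> 'M[C]_n.+1) (D : I -> 'M[C]_n.+1) : Prop :=
  [/\ forall w, unitary_family (U w), bm_family E U, left_invariant E U D,
     forall i, power_bound k b (D i) & forall i, ntr (D i) = 0].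

Definition moment2 (Om : Type) n (E : expectation_form C Om)
    (U : Om -> J -> 'M[C]_n.+1) (D : I -> 'M[C]_n.+1) x : C :=
  Ex E (fun w => `|ntr (word_mx (U w) D x)| ^+ 2).

Definition moment2_bound L (K : C) : Prop :=
  forall (Om : Type) n (E : expectation_form C Om)
    (U : Om -> J -> 'M[C]_n.+1) (D : I -> 'M[C]_n.+1),
  centered_system E U D -> forall x, reduced x -> (0 < size x <= L)%N ->
  (nconst x <= q)%N -> moment2 E U D x <= K / n.+1%:R ^+ 2.

(** In the loop equation for a rotation X of the word and its adjoint, the term of the first letter
    is |tr X|^2. The other terms contain the trace of a shorter reduced word, and their share of |tr
    X|^2 is small enough to be absorbed. *)
Lemma moment2_step L (K : C) (Om : Type) n (E : expectation_form C Om)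
    (U : Om -> J -> 'M[C]_n.+1) (D : I -> 'M[C]_n.+1) s j y z :
  0 <= K -> moment2_bound L K -> centered_system E U D ->
  reduced ((s, inl j) :: y) -> (size y <= L)%N ->
  all (@is_const J I) z -> (size z <= 1)%N -> (nconst (y ++ z) <= q)%N ->
  moment2 E U D ((s, inl j) :: y ++ z) <=
    (4 * L.+2%:R ^+ 2 * b ^+ 2 * K + 4 * L.+2%:R * b) / n.+1%:R ^+ 2.
Proof.
move=> K0 HK sys; have [Uu bmU invU Db Dc] := sys.
set a := (s, inl j) => red yL zc z1 nyz.
have b0 : 0 <= b by exact: le_trans ler01 b1.
pose tr x w := ntr (word_mx (U w) D x).
have bmtr x : bm E (tr x) by exact: bm_ntr_word.
have bmtr2 x : bm E (fun w => `|tr x w| ^+ 2).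
  by apply: bm_ext (bmM (bmtr x) (bm_conj (bmtr x))) => w; rewrite normCK.
have trb x w : (nconst x <= 2 * q)%N -> `|tr x w| <= b.
  by move=> hx; apply: (ntr_word_bound b1 (Uu w) Db); exact: leq_ltn_trans hx qk.
(* A cut falls before u_j but after u_j^*. The letter [a] is placed at the end where its own cut
   leaves one factor empty, so that its term is tr(1) tr(X). *)
pose X := if s then a :: y ++ z else y ++ z ++ [:: a].
have nX : nconst X = nconst (y ++ z).
  by rewrite /X; case: (s); rewrite /nconst /= !count_cat/= ?addn0 ?add0n.
have sX : size X = (size y + size z).+1.
  by rewrite /X; case: (s); rewrite /= !size_cat//= addn1 addnS.
have trX w : tr X w = tr (a :: y ++ z) w.
  by rewrite /X; case: (s) => //; rewrite /tr catA ntr_word_catC.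
pose m := L.+2; have sXm : (size X <= m)%N by rewrite sX /m; lia.
have m0 : 0 < m%:R :> C by rewrite ltr0n.
(* [T] lists the terms other than that of [a]. If [a] stands last, their second factors end in
   [a]. *)
have [T [sT hT eT]] : exists T : seq (bool * (seq letter * seq letter)),
  [/\ (size T <= m)%N,
   forall t, t \in T -> (nconst t.2.2 <= 2 * q)%N /\ exists x,
     [/\ reduced x, (0 < size x <= L)%N, (nconst x <= q)%N &
       forall w, tr t.2.1 w = tr x w] &
   forall w, \sum_(t <- split_terms j [::] X)
     bool_sign C t.1 * (tr t.2.1 w * tr t.2.2 w * tr (word_adj X) w) =
     bool_sign C s * `|tr X w| ^+ 2 +
     \sum_(t <- T) bool_sign C t.1 * (tr t.2.1 w * tr t.2.2 w * (tr X w)^*)].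
  pose T0 := split_terms j (if s then [:: a] else [::]) (y ++ z).
  have trY w : tr (word_adj X) w = (tr X w)^* by rewrite /tr word_mx_adj ntr_adj.
  have hT0 t : t \in T0 -> (nconst t.2.1 + nconst t.2.2 <= q)%N /\ exists x,
     [/\ reduced x, (0 < size x <= L)%N, (nconst x <= q)%N &
       forall w, tr t.2.1 w = tr x w].
    move=> tT; split.
      by rewrite (split_terms_nconst tT); case: (s).
    have := @split_terms_shorter C J I s j [::] y z t red zc tT.
    move=> [x [rx /andP[x0 xy] /= nx ex]]; exists x; split => //.
    - by rewrite x0 (leq_trans xy).
    - by apply: leq_trans nyz; apply: leq_trans nx _; rewrite /nconst count_cat leq_addr.
    - by move=> w; exact: ex.
  have sT0 : (size T0 <= m)%N.
    apply: leq_trans (size_split_terms _ _ _) _; rewrite size_cat /m; lia.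
  exists (if s then T0 else [seq (t.1, (t.2.1, t.2.2 ++ [:: a])) | t <- T0]).
  split.
  - by case: (s); rewrite ?size_map.
  - case Es: s T0 hT0 {sT0} => T0 hT0 t.
      by move=> /hT0 [h1 h2]; split => //; lia.
    move=> /mapP[t' /hT0[h1 h2] ->]; split => //=.
    rewrite /nconst count_cat /= !addn0; apply: leq_trans (leq_trans (leq_addl _ _) h1) _.
    by rewrite leq_pmull.
  - move=> w; have tr0 : tr [::] w = 1 by rewrite /tr word_mx_nil ntr1.
    have sumE (T1 : seq (bool * (seq letter * seq letter))) :
        \sum_(t <- T1) bool_sign C t.1 *
          (tr t.2.1 w * tr t.2.2 w * tr (word_adj X) w) =
        \sum_(t <- T1) bool_sign C t.1 * (tr t.2.1 w * tr t.2.2 w * (tr X w)^*).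
      by apply: eq_bigr => t _; rewrite trY.
    rewrite sumE {1}/X /T0; case Es: s.
      rewrite /= eqxx/= big_cons /= Es /= tr0 mul1r normCK.
      by congr (_ * (_ * _) + _); rewrite /X Es.
    rewrite catA split_terms_cat big_cat/= eqxx/= big_seq1/= addrC Es /=.
    rewrite tr0 mulr1 normCK; congr (_ * (_ * _) + _).
    by rewrite /X Es -cats1 catA /a Es.
pose A := Ex E (fun w => `|tr X w| ^+ 2).
have -> : moment2 E U D (a :: y ++ z) = A by apply: Ex_ext => w; rewrite trX.
pose R w := \sum_(t <- split_terms j [::] (word_adj X))
  bool_sign C t.1 * tr (X ++ t.2.2 ++ t.2.1) w.
pose S w := \sum_(t <- T)
  bool_sign C t.1 * (tr t.2.1 w * tr t.2.2 w * (tr X w)^*).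
have bmS : bm E S.
  apply: bm_sum => t; apply: bmZ; apply: bmM; last exact: bm_conj.
  exact: bmM.
have bmR : bm E R by apply: bm_sum => t; exact: bmZ.
have sign1 c : `|bool_sign C c| = 1 by rewrite normrX normrN1 expr1n.
have loop : bool_sign C s * A = - Ex E S - n.+1%:R ^- 2 * Ex E R.
  have := loop_equation bmU invU j X (word_adj X).
  rewrite (Ex_ext E eT) ExD; [|exact: bmZ|by []].
  by rewrite ExZ// => h; rewrite -[LHS](addrK (Ex E S)) h addrC.
have A0 : 0 <= A by apply: Ex_ge0 => // w; rewrite exprn_ge0.
pose N2 : C := n.+1%:R ^- 2.
have N20 : 0 <= N2 by rewrite invr_ge0 exprn_ge0.
(* The weight 1/(4m) is chosen so that at most m terms, doubled by [norm_Ex], contribute at most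
   A/2; completing the square dictates the other weight m b^2. *)
pose G w := \sum_(t <- T) ((4 * m%:R)^-1 * `|tr X w| ^+ 2 +
  m%:R * b ^+ 2 * `|tr t.2.1 w| ^+ 2).
have bmG : bm E G by apply: bm_sum => t; apply: bmD; exact: bmZ.
have SG w : `|S w| <= G w.
  apply: le_trans (ler_norm_sum _ _ _) _.
  rewrite /G !big_seq; apply: ler_sum => t /hT [h _].
  rewrite normrM sign1 mul1r 2!normrM norm_conjC.
  set u := `|tr t.2.1 w|; set v := `|tr X w|.
  have u0 : 0 <= u by exact: normr_ge0.
  have v0 : 0 <= v by exact: normr_ge0.
  apply: le_trans (_ : u * b * v <= _).
    by apply: ler_wpM2r => //; apply: ler_wpM2l => //; exact: trb.
  have -> : (4 * m%:R)^-1 * v ^+ 2 + m%:R * b ^+ 2 * u ^+ 2 =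
      u * b * v + (4 * m%:R)^-1 * (v - 2 * m%:R * b * u) ^+ 2.
    by field; rewrite pnatr_eq0.
  rewrite lerDl; apply: mulr_ge0; first by rewrite invr_ge0 mulr_ge0// ltW.
  apply: real_exprn_even_ge0 => //; apply: rpredB; apply: ger0_real => //.
  by rewrite !mulr_ge0// ltW.
have hS : `|Ex E S| <= 2 * (m%:R * ((4 * m%:R)^-1 * A + m%:R * b ^+ 2 * (K * N2))).
  apply: le_trans (norm_Ex bmS bmG SG) _; rewrite ler_wpM2l//.
  rewrite Ex_sum; last by move=> t; apply: bmD; exact: bmZ.
  apply: le_trans (_ : \sum_(t <- T) ((4 * m%:R)^-1 * A + m%:R * b ^+ 2 * (K * N2)) <= _).
    rewrite !big_seq; apply: ler_sum => t /hT [_ [x [rx x0 nx ex]]].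
    rewrite ExD; [|exact: bmZ|exact: bmZ]; rewrite !ExZ// lerD2l ler_wpM2l//.
      by rewrite mulr_ge0// exprn_ge0.
    have := HK _ _ _ _ _ sys x rx x0 nx; rewrite /moment2; apply: le_trans.
    apply: le_Ex; [exact: bmtr2|exact: (bmtr2 x)|by move=> w; rewrite ex].
  rewrite big_const_seq count_predT iter_addr_0 -[X in X <= _]mulr_natl.
  apply: ler_wpM2r; last by rewrite ler_nat.
  by rewrite addr_ge0// !mulr_ge0 ?invr_ge0 ?mulr_ge0 ?exprn_ge0.
have hR : `|Ex E R| <= 2 * (m%:R * b).
  rewrite -(Ex_cst E (m%:R * b)); apply: norm_Ex => //; first exact: bm_cst.
  move=> w; apply: le_trans (ler_norm_sum _ _ _) _.
  apply: le_trans (_ : \sum_(t <- split_terms j [::] (word_adj X)) b <= _).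
    rewrite !big_seq; apply: ler_sum => t /split_terms_nconst.
    rewrite nconst_adj /= add0n => ht; rewrite normrM sign1 mul1r; apply: trb.
    rewrite /nconst !count_cat [(count _ t.2.2 + _)%N]addnC -!/(nconst _) ht nX.
    by rewrite addnn -mul2n leq_pmul2l.
  rewrite big_const_seq count_predT iter_addr_0 -[X in X <= _]mulr_natl.
  apply: ler_wpM2r => //; rewrite ler_nat.
  apply: leq_trans (size_split_terms _ _ _) _.
  by rewrite size_rev size_map.
have half : A <= 2^-1 * A + 2 * m%:R ^+ 2 * b ^+ 2 * K * N2 + 2 * m%:R * b * N2.
  have {1}-> : A = `|bool_sign C s * A| by rewrite normrM sign1 mul1r ger0_norm.
  rewrite loop; apply: le_trans (ler_normB _ _) _.
  rewrite normrN normrM (ger0_norm N20) -/N2.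
  apply: le_trans (lerD hS (ler_wpM2l N20 hR)) _.
  by rewrite le_eqVlt; apply/orP; left; apply/eqP; field; rewrite pnatr_eq0.
have -> : (4 * m%:R ^+ 2 * b ^+ 2 * K + 4 * m%:R * b) / n.+1%:R ^+ 2 =
  2 * ((2^-1 * A + 2 * m%:R ^+ 2 * b ^+ 2 * K * N2 + 2 * m%:R * b * N2) - 2^-1 * A).
  by rewrite -/N2; ring.
have {1}-> : A = 2 * (A - 2^-1 * A) by field.
by rewrite ler_wpM2l// lerB.
Qed.

Lemma moment2_boundE L : exists2 K, 0 <= K & moment2_bound L K.
Proof.
have b0 : 0 <= b by exact: le_trans ler01 b1.
elim: L => [|L [K K0 HK]].
  by exists 0 => // Om n E U D _ x _ /andP[x0]; rewrite leqNgt x0.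
exists (4 * L.+2%:R ^+ 2 * b ^+ 2 * K + 4 * L.+2%:R * b).
  by rewrite addr_ge0 ?mulr_ge0 ?exprn_ge0.
move=> Om n E U D sys [//|[c [j|i]] x] red /= sx nx.
  have := @moment2_step L K Om n E U D c j x [::] K0 HK sys red sx isT isT.
  by rewrite cats0; apply.
have [_ _ _ _ Dc] := sys.
case: x red sx nx => [|[c' [j|//]] x] red sx nx.
  (* A word consisting of one constant has trace 0: this is where the induction uses that the
     constants are centered. *)
  rewrite /moment2 (_ : Ex E _ = 0).
    by rewrite mulr_ge0 ?addr_ge0 ?invr_ge0 ?mulr_ge0 ?exprn_ge0.
  rewrite -(Ex_cst E 0); apply: Ex_ext => w; rewrite word_mx1 /letter_mx/=.
  by case: c {red sx nx}; rewrite ?ntr_adj Dc ?conjC0 normr0 expr0n.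
have red' : reduced ((c', inl j) :: x) by [].  
have := @moment2_step L K Om n E U D c' j x [:: (c, inr i)] K0 HK sys red'.
have -> : moment2 E U D [:: (c, inr i), (c', inl j) & x] =
    moment2 E U D ((c', inl j) :: x ++ [:: (c, inr i)]).
  apply: Ex_ext => w; rewrite -[(c, inr i) :: _]cat1s ntr_word_catC.
  by rewrite -cat_cons.
apply => //; first exact: ltnW.
by move: nx; rewrite /nconst/= count_cat/= addn0 add0n addnC.
Qed.
End Induction.

(** * Haar unitaries *)

Local Open Scope classical_set_scope.

Section ComplexExpectation.
Variables (R : realType) (d : measure_display) (T : measurableType d).
Variable P : probability T R.
Local Notation C := (Cplx R).
Local Notation re := (@complex.Re R).
Local Notation im := (@complex.Im R).
Implicit Types (f g : T -> C).

Lemma reD (x y : C) : re (x + y) = re x + re y. Proof. by case: x; case: y. Qed.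
Lemma imD (x y : C) : im (x + y) = im x + im y. Proof. by case: x; case: y. Qed.
Lemma reM (x y : C) : re (x * y) = re x * re y - im x * im y.
Proof. by case: x; case: y. Qed.
Lemma imM (x y : C) : im (x * y) = re x * im y + im x * re y.
Proof. by case: x; case: y. Qed.
Lemma re_conj (x : C) : re (x^*) = re x. Proof. by case: x. Qed.
Lemma im_conj (x : C) : im (x^*) = - im x. Proof. by case: x. Qed.
Lemma complex_ext (x y : C) : re x = re y -> im x = im y -> x = y.
Proof. by case: x => a b; case: y => a' b' /= -> ->. Qed.

Definition complex_measurable f :=
  measurable_fun setT (fun w => re (f w)) /\ measurable_fun setT (fun w => im (f w)).

Definition bounded_measurable f := complex_measurable f /\
  exists K : R, forall w, `|re (f w)| <= K /\ `|im (f w)| <= K.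

Definition complex_expectation f : C :=
  Complex (\int[P]_w re (f w)) (\int[P]_w im (f w)).

Lemma complex_measurable_cst c : complex_measurable (fun _ => c).
Proof. by split; exact: measurable_cst. Qed.

Lemma complex_measurableD f g : complex_measurable f -> complex_measurable g ->
  complex_measurable (fun w => f w + g w).
Proof.
move=> [f1 f2] [g1 g2]; split.
  by under eq_fun do rewrite reD; exact: measurable_funD.
by under eq_fun do rewrite imD; exact: measurable_funD.
Qed.

Lemma complex_measurableM f g : complex_measurable f -> complex_measurable g ->
  complex_measurable (fun w => f w * g w).
Proof.
move=> [f1 f2] [g1 g2]; split.
  under eq_fun do rewrite reM.
  by apply: measurable_funB; exact: measurable_funM.
under eq_fun do rewrite imM.
by apply: measurable_funD; exact: measurable_funM.
Qed.

Lemma complex_measurable_conj f : complex_measurable f ->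
  complex_measurable (fun w => (f w)^*).
Proof.
move=> [f1 f2]; split; first by under eq_fun do rewrite re_conj.
by under eq_fun do rewrite im_conj; exact: measurableT_comp.
Qed.

Lemma complex_measurable_sum (I : Type) (r : seq I) (F : I -> T -> C) :
  (forall i, complex_measurable (F i)) ->
  complex_measurable (fun w => \sum_(i <- r) F i w).
Proof.
move=> hF; elim: r => [|i r IH].
  under eq_fun do rewrite big_nil; exact: complex_measurable_cst.
by under eq_fun do rewrite big_cons; exact: complex_measurableD.
Qed.

Lemma bounded_integrable (f : T -> R) (K : R) : measurable_fun setT f ->
  (forall w, `|f w| <= K) -> P.-integrable setT (EFin \o f).
Proof.
move=> mf fK; apply: measurable_bounded_integrable => //.
  exact: le_lt_trans (probability_le1 P measurableT) (ltry 1).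
by exists K; split; [exact: num_real|move=> x Kx w _; exact: le_trans (fK w) (ltW Kx)].
Qed.

Lemma bounded_measurable_integrable f : bounded_measurable f ->
  P.-integrable setT (EFin \o (fun w => re (f w))) /\ P.-integrable setT (EFin \o (fun w => im (f w))).
Proof.
move=> [[f1 f2] [K fK]]; split.
  by apply: (bounded_integrable (K := K)) => // w; exact: (fK w).1.
by apply: (bounded_integrable (K := K)) => // w; exact: (fK w).2.
Qed.

Lemma bounded_measurable_cst c : bounded_measurable (fun _ => c).
Proof.
split; first exact: complex_measurable_cst.
by exists (`|re c| + `|im c|) => _; rewrite lerDl lerDr !normr_ge0.
Qed.

Lemma bounded_measurableD f g : bounded_measurable f -> bounded_measurable g ->
  bounded_measurable (fun w => f w + g w).
Proof.
move=> [mf [K fK]] [mg [L gL]]; split; first exact: complex_measurableD.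
exists (K + L) => w; have [? ?] := fK w; have [? ?] := gL w.
by rewrite reD imD; split; apply: le_trans (ler_normD _ _) _; exact: lerD.
Qed.

Lemma bounded_measurableM f g : bounded_measurable f -> bounded_measurable g ->
  bounded_measurable (fun w => f w * g w).
Proof.
move=> [mf [K fK]] [mg [L gL]]; split; first exact: complex_measurableM.
exists (K * L + K * L) => w; have [? ?] := fK w; have [? ?] := gL w.
rewrite reM imM; split.
  by apply: le_trans (ler_normB _ _) _; rewrite !normrM lerD// ler_pM.
by apply: le_trans (ler_normD _ _) _; rewrite !normrM lerD// ler_pM.
Qed.

Lemma bounded_measurable_conj f : bounded_measurable f ->
  bounded_measurable (fun w => (f w)^*).
Proof.
move=> [mf [K fK]]; split; first exact: complex_measurable_conj.
by exists K => w; rewrite re_conj im_conj normrN; exact: fK.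
Qed.

Lemma bounded_measurable_bounded f : bounded_measurable f ->
  exists2 K : C, 0 <= K & forall w, `|f w| <= K.
Proof.
move=> [_ [K fK]].
have nle (z : C) : `|z| <= (`|re z| + `|im z|)%:C%C.
  rewrite {1}(complexE z); apply: le_trans (ler_normD _ _) _.
  rewrite normrM !normc_def /= !expr0n/= !addr0 !sqrtr_sqr.
  by rewrite add0r expr1n sqrtr1 mul1r -rmorphD.
exists (`|K| + `|K|)%:C%C; first by rewrite ler0c addr_ge0.
move=> w; apply: le_trans (nle _) _; rewrite lecR; have [h1 h2] := fK w.
by apply: lerD; [apply: le_trans h1 _|apply: le_trans h2 _]; exact: ler_norm.
Qed.

Lemma complex_expectationD f g : bounded_measurable f -> bounded_measurable g ->
  complex_expectation (fun w => f w + g w) =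
  complex_expectation f + complex_expectation g.
Proof.
move=> /bounded_measurable_integrable[f1 f2] /bounded_measurable_integrable[g1 g2].
apply: complex_ext; rewrite ?reD ?imD /=.
  under eq_Rintegral do rewrite reD; exact: RintegralD.
under eq_Rintegral do rewrite imD; exact: RintegralD.
Qed.

Lemma complex_expectationZ c f : bounded_measurable f ->
  complex_expectation (fun w => c * f w) = c * complex_expectation f.
Proof.
move=> /bounded_measurable_integrable[f1 f2].
have iZ (a : R) (h : T -> R) : P.-integrable setT (EFin \o h) ->
    P.-integrable setT (EFin \o (fun w => a * h w)).
  by move=> ih; exact: (integrableZl measurableT a ih).
apply: complex_ext; rewrite ?reM ?imM /=.
  under eq_Rintegral do rewrite reM.
  by rewrite RintegralB//; [rewrite !RintegralZl//|exact: iZ|exact: iZ].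
under eq_Rintegral do rewrite imM.
by rewrite RintegralD//; [rewrite !RintegralZl//|exact: iZ|exact: iZ].
Qed.

Lemma complex_expectation_ge0 f : bounded_measurable f -> (forall w, 0 <= f w) ->
  0 <= complex_expectation f.
Proof.
move=> _ f0; rewrite lecE /=; apply/andP; split.
  have im0 w : im (f w) = 0.
    by move: (f0 w); rewrite lecE => /andP[/eqP].
  by under eq_Rintegral do rewrite im0; rewrite Rintegral_cst// mul0r.
by apply: Rintegral_ge0 => w _; move: (f0 w); rewrite lecE => /andP[].
Qed.

Lemma complex_expectation1 : complex_expectation (fun _ => 1) = 1.
Proof.
apply: complex_ext; rewrite /= Rintegral_cst//; last by rewrite mul0r.
by rewrite [X in fine X]probability_setT/= mulr1.
Qed.

Definition probability_expectation : expectation_form C T :=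
  @ExpectationForm C T bounded_measurable complex_expectation
    bounded_measurable_cst bounded_measurableD bounded_measurableM
    bounded_measurable_conj bounded_measurable_bounded
    complex_expectationD complex_expectationZ complex_expectation_ge0
    complex_expectation1 
    (fun f g (fg : f =1 g) => congr1 complex_expectation (funext fg))
    (fun f g (fg : f =1 g) mf => eq_ind f bounded_measurable mf g (funext fg)).

End ComplexExpectation.

(** * Borel measurability on matrices *)

Section BorelMatrices.
Variables (R : realType) (n : nat).
Local Notation C := (Cplx R).
Local Notation re := (@complex.Re R).
Local Notation im := (@complex.Im R).
Local Notation M := 'M[C]_n.+1.
Local Notation BM := (mxborel R n).

Lemma borel_open (A : set M) : open A -> measurable (A : set BM).
Proof. by move=> oA; exact: sub_sigma_algebra. Qed.

(** For [phi] the real or the imaginary part: being additive and 1-Lipschitz, it pulls open rays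
    back to open sets. *)
Lemma measurable_entry_part (phi : C -> R) i j :
  (forall x y, phi (x - y) = phi x - phi y) ->
  (forall x, `|phi x|%:C%C <= `|x|) ->
  measurable_fun setT (fun W : BM => phi ((W : M) i j)).
Proof.
move=> phiB phin; apply: (measurability _ (RGenOInfty.measurableE R)).
move=> _ [_ [x ->] <-]; rewrite setTI; apply: borel_open.
apply: (@open_comp M C (fun W => W i j) (phi @^-1` `]x, +oo[)).
  by move=> W _; exact: coord_continuous.
rewrite openE => z /=; rewrite in_itv/= andbT => xz.
apply/nbhs_ballP; exists (phi z - x)%:C%C; first by rewrite /= ltcR subr_gt0.
move=> t /=; rewrite /ball/= => zt; rewrite in_itv/= andbT.
have := le_lt_trans (phin (z - t)) zt; rewrite phiB ltcR => h.
have := le_lt_trans (ler_norm _) h; lra.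
Qed.

Lemma norm_im_le (x : C) : `|im x|%:C%C <= `|x|.
Proof.
have := normc_ge_Re (x * 'i%C).
by rewrite ReiNIm normrN normrM [X in _ <= _ * X](_ : _ = 1) ?mulr1// normc_def /=
  expr0n/= add0r expr1n sqrtr1.
Qed.

Lemma complex_measurable_entry i j :
  complex_measurable (fun W : BM => (W : M) i j).
Proof.
split; apply: measurable_entry_part.
- by case=> a b; case.
- exact: normc_ge_Re.
- by case=> a b; case.
- exact: norm_im_le.
Qed.

Lemma continuous_mulmxl (V : M) : continuous (fun W : M => V * W).
Proof.
move=> W A [Q hQ QA].
(* A matrix neighbourhood contains a box of neighbourhoods [Q i j] of the entries, so continuity is
   checked entry by entry. *)
have hc i j : (fun W : M => (V * W) i j) x @[x --> W] --> (V * W) i j.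
  have E W' : (V * W') i j = \sum_(k <- index_enum 'I_n.+1) V i k * W' k j.
    by rewrite -mulmxE mxE.
  under eq_cvg do rewrite E; rewrite E.
  apply: (@cvg_big C _ +%R 0 xpredT (@add_continuous C) M (nbhs W)) => k _.
  apply: cvgM; [exact: cvg_cst|exact: coord_continuous].
have h : \forall W' \near W, forall i, forall j, Q i j ((V * W') i j).
  apply: (@filter_forall M 'I_n.+1
    (fun i W' => forall j, Q i j ((V * W') i j)) (nbhs W)) => i.
  apply: (@filter_forall M 'I_n.+1
    (fun j W' => Q i j ((V * W') i j)) (nbhs W)) => j.
  by apply: hc; exact: hQ.
by apply: filterS h => W' hW'; exact: QA.
Qed.

Lemma measurable_mulmxl (V : M) :
  measurable_fun setT (fun W : BM => (V * (W : M) : BM)).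
Proof.
apply: (@measurability _ _ BM BM _ _ (@open M)) => //.
move=> _ [A oA <-]; rewrite setTI; apply: borel_open.
by apply: open_comp oA => W _; exact: continuous_mulmxl.
Qed.

Definition unitary_set : set BM := [set V : M | V \is unitarymx].

Lemma measurable_unitary_set : measurable unitary_set.
Proof.
have -> : unitary_set = \bigcap_(i in [set: 'I_n.+1]) \bigcap_(j in [set: 'I_n.+1])
   ((fun W : BM => re (((W : M) * (W : M)^t*) i j)) @^-1` [set re ((1 : M) i j)] `&`
    (fun W : BM => im (((W : M) * (W : M)^t*) i j)) @^-1` [set im ((1 : M) i j)]).
  apply/seteqP; split => W /=.
    by move=> /unitarymxP WW i _ j _ /=; rewrite -mulmxE WW.
  move=> h; apply/unitarymxP/matrixP => i j.
  by have [h1 h2] := h i I j I; exact: complex_ext.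
have mc i j : complex_measurable (fun W : BM => ((W : M) * (W : M)^t*) i j).
  rewrite (_ : (fun _ => _) = (fun W : BM =>
     \sum_(k <- index_enum 'I_n.+1) (W : M) i k * ((W : M) j k)^*)); last first.
    by apply: funext => W'; rewrite -mulmxE mxE; apply: eq_bigr => k _; rewrite !mxE.
  apply: complex_measurable_sum => k; apply: complex_measurableM.
    exact: complex_measurable_entry.
  by apply: complex_measurable_conj; exact: complex_measurable_entry.
apply: fin_bigcap_measurable => // i _; apply: fin_bigcap_measurable => // j _.
have [h1 h2] := mc i j; apply: measurableI.
  by rewrite -[X in measurable X]setTI; exact: h1.
by rewrite -[X in measurable X]setTI; exact: h2.
Qed.

(* A Haar distributed matrix is unitary almost surely only; unitarize makes it
   unitary everywhere without changing its law. *)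
Definition unitarize (W : BM) : BM :=
  if (W : M) \is unitarymx then W else (1 : M).

Lemma unitarize_unitary W : (unitarize W : M) \is unitarymx.
Proof.
by rewrite /unitarize; case: ifP => //= _; apply/unitarymxP; rewrite mulmxE adjmx1 mulr1.
Qed.

Lemma unitarize_id (W : M) : W \is unitarymx -> unitarize W = W.
Proof. by rewrite /unitarize => ->. Qed.

Lemma measurable_unitarize : measurable_fun setT unitarize.
Proof.
apply: measurable_fun_ifT.
- apply: (@measurable_fun_bool _ _ _ _ true); rewrite setTI.
  exact: measurable_unitary_set.
- exact: measurable_id.
- exact: measurable_cst.
Qed.
End BorelMatrices.

(** * Change of variables and equality of laws *)

Section Transfer.
Variables (R : realType) (d d' : measure_display).
Variables (T : measurableType d) (T' : measurableType d').
Local Notation C := (Cplx R).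

Lemma complex_expectation_distribution (P : probability T R) (X : {RV P >-> T'})
    (F : T' -> C) : bounded_measurable F ->
  complex_expectation (distribution P X) F = complex_expectation P (F \o X).
Proof.
move=> [[mre mim] [K FK]].
apply: complex_ext; rewrite /= /Rintegral integral_distribution//.
- exact/measurable_EFinP.
- apply: (@bounded_integrable R _ _ P (fun w => complex.Re (F (X w))) K).
    exact: (measurableT_comp mre (measurable_funPT X)).
  by move=> w; exact: (FK _).1.
- exact/measurable_EFinP.
- apply: (@bounded_integrable R _ _ P (fun w => complex.Im (F (X w))) K).
    exact: (measurableT_comp mim (measurable_funPT X)).
  by move=> w; exact: (FK _).2.
Qed.

Lemma eq_complex_expectation (P Q : probability T R) (F : T -> C) :
  (forall A, measurable A -> P A = Q A) ->
  complex_expectation P F = complex_expectation Q F.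
Proof.
move=> PQ; apply: complex_ext; rewrite /= /Rintegral; congr fine;
  by apply: eq_measure_integral => A mA _; exact: PQ.
Qed.

(** Boxes are stable under intersection and generate the product sigma-algebra, so the uniqueness
    theorem for measures applies. *)
Lemma eq_tuple_probability k (P Q : probability (k.-tuple T) R) :
  (forall A : 'I_k -> set T, (forall i, measurable (A i)) ->
    P [set v | forall i, A i (tnth v i)] = Q [set v | forall i, A i (tnth v i)]) ->
  forall B, measurable B -> P B = Q B.
Proof.
move=> PQ.
pose G : set (set (k.-tuple T)) :=
  [set B | exists2 A : 'I_k -> set T, (forall i, measurable (A i)) &
     B = [set v | forall i, A i (tnth v i)]].
apply: (measure_unique G (fun=> setT)).
- apply/seteqP; split.
    apply: smallest_sub; first exact: smallest_sigma_algebra.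
    move=> B; rewrite -bigcup_seq => -[i _ [A mA <-]].
    apply: sub_sigma_algebra; exists (fun j => if j == i then A else setT).
      by move=> j; case: ifP.
    apply/seteqP; split => v /=; rewrite ?setTI.
      by move=> Av j; case: eqP => // ->; exact: Av.2.
    by move=> h; have := h i; rewrite eqxx; split.
  apply: smallest_sub; first exact: sigma_algebra_measurable.
  move=> _ [A mA ->].
  rewrite (_ : [set v | _] = \bigcap_(i in [set: 'I_k]) ((@tnth _ T)^~ i @^-1` A i)).
    apply: fin_bigcap_measurable => // i _.
    by rewrite -[X in measurable X]setTI; exact: (@measurable_tnth _ T k i).
  by apply/seteqP; split => v /= h i; [move=> _; exact: h|exact: (h i I)].
- move=> _ _ [A mA ->] [B mB ->]; exists (fun i => A i `&` B i).
    by move=> i; exact: measurableI.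
  apply/seteqP; split => v /=; first by move=> [h1 h2] i; split.
  by move=> h; split => i; case: (h i).
- by move=> _; exists (fun=> setT) => //; apply/seteqP; split.
- by apply/seteqP; split => // v _; exists 0%N.
- by move=> _ [A mA ->]; exact: PQ.
- by move=> _; exact: le_lt_trans (probability_le1 P measurableT) (ltry 1).
Qed.
End Transfer.

Lemma probability_setI_full (R : realType) d (T : measurableType d)
    (P : probability T R) (A B : set T) :
  measurable A -> measurable B -> P B = 1%E -> P (A `&` B) = P A.
Proof.
move=> mA mB PB; rewrite [RHS](measureDI P mA mB).
have D0 : P (A `\` B) = 0%E.
  apply: (subset_measure0 (measurableD mA mB) (measurableC mB)).
    by move=> x [].
  by have := probability_setC P mB; rewrite PB subee.
by rewrite [X in (X + _)%E]D0 add0e.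
Qed.

(** * Joint law of independent Haar unitaries *)

Section HaarSystem.
Variables (R : realType) (n k : nat) (d : measure_display) (T : measurableType d).
Variables (P : probability T R) (U : 'I_k -> {RV P >-> mxborel R n}).
Hypotheses (haarU : forall i, standard_unitary (U i)) (indU : independent_RVs U).
Local Notation C := (Cplx R).
Local Notation M := 'M[C]_n.+1.
Local Notation BM := (mxborel R n).

(** The rows of a unitary matrix are unit vectors, so its entries are bounded by 1. *)
Lemma bounded_measurable_entry (d' : measure_display) (T' : measurableType d')
    (g : T' -> BM) i j : measurable_fun setT g ->
  (forall w, (g w : M) \is unitarymx) ->
  bounded_measurable (fun w => (g w : M) i j).
Proof.
move=> mg ug; have [e1 e2] := complex_measurable_entry R i j.
split; first by split; [exact: (measurableT_comp e1 mg)|exact: (measurableT_comp e2 mg)].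
exists 1 => w; have h : `|(g w : M) i j| <= 1.
  rewrite -(@ler_pXn2r _ 2) ?nnegrE// expr1n.
  have /unitarymxP/matrixP/(_ i i) := ug w; rewrite !mxE eqxx => h; rewrite -[1 in leRHS]h.
  rewrite (bigD1 j)//= !mxE -normCK lerDl; apply: sumr_ge0 => l _.
  by rewrite !mxE -normCK exprn_ge0.
split; rewrite -lecR.
  exact: le_trans (normc_ge_Re _) h.
exact: le_trans (norm_im_le _) h.
Qed.

Lemma haar_unitary i : P (U i @^-1` @unitary_set R n) = 1%E.
Proof. exact: (haarU i).1. Qed.

Lemma haar_translate i (V : M) (A : set BM) : V \is unitarymx -> measurable A ->
  P (U i @^-1` [set (V *m (W : M) : BM) | W in A]) = P (U i @^-1` A).
Proof. exact: (haarU i).2. Qed.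

Lemma measurable_preimage_rv i (A : set BM) : measurable A ->
  measurable (U i @^-1` A).
Proof. by move=> mA; rewrite -[X in measurable X]setTI; exact: measurable_funPT. Qed.

Lemma probability_unitarize i (B : set BM) : measurable B ->
  P (U i @^-1` (@unitarize R n @^-1` B)) = P (U i @^-1` B).
Proof.
move=> mB; have mS := measurable_preimage_rv i (@measurable_unitary_set R n).
have mpre : measurable (@unitarize R n @^-1` B).
  by rewrite -[X in measurable X]setTI; exact: measurable_unitarize.
rewrite -(probability_setI_full (measurable_preimage_rv i mpre) mS (haar_unitary i)).
rewrite -(probability_setI_full (measurable_preimage_rv i mB) mS (haar_unitary i)).
congr (P _); apply/seteqP; split => w [h1 h2]; split=> //.
  by move: h1; rewrite /preimage/= unitarize_id.
by rewrite /preimage/= unitarize_id.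
Qed.

Definition unitarized (w : T) (i : 'I_k) : M := unitarize (U i w).

Lemma unitarized_family w : unitary_family (unitarized w).
Proof.
move=> i; apply: mulmx1C; apply/unitarymxP; exact: unitarize_unitary.
Qed.

Lemma measurable_unitarized i : measurable_fun setT (fun w => unitarized w i : BM).
Proof. exact: (measurableT_comp (@measurable_unitarize R n) (measurable_funPT (U i))). Qed.

Lemma unitarized_law (A : 'I_k -> set BM) : (forall i, measurable (A i)) ->
  P [set w | forall i, A i (unitarized w i)] =
  (\prod_(i < k) P (U i @^-1` A i))%E.
Proof.
move=> mA; pose A' i := @unitarize R n @^-1` A i.
have mA' i : measurable (A' i).
  by rewrite -[X in measurable X]setTI; exact: measurable_unitarize.
rewrite (_ : [set w | _] = \bigcap_i (U i @^-1` A' i)); last first.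
  by apply/seteqP; split => w /= h i; [move=> _; exact: h|exact: (h i I)].
rewrite (indU (t := id)) //; apply: eq_bigr => i _.
exact: (probability_unitarize i (mA i)).
Qed.

(** By independence a box has a product probability, and the translation changes only factor [j],
    where Haar invariance applies. *)
Lemma unitarized_translate_law j (V : M) (A : 'I_k -> set BM) :
  V * V^t* = 1 -> (forall i, measurable (A i)) ->
  P [set w | forall i, A i (translate (unitarized w) j V i)] =
  P [set w | forall i, A i (unitarized w i)].
Proof.
move=> VV mA; pose B i := if i == j then (fun W : BM => V * (W : M) : BM) @^-1` A i else A i.
have mB i : measurable (B i).
  rewrite /B; case: ifP => // _.
  by rewrite -[X in measurable X]setTI; exact: measurable_mulmxl.
have -> : [set w | forall i, A i (translate (unitarized w) j V i)] =
    [set w | forall i, B i (unitarized w i)].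
  apply/seteqP; split => w /= h i; have := h i;
  by rewrite /translate /B; case: eqP.
rewrite !unitarized_law//; apply: eq_bigr => i _.
rewrite /B; case: eqP => // ij.
have Vu : V \is unitarymx by apply/unitarymxP.
(* Invariance is stated for images V A, so it is applied to the preimage of [A i] under W -> V W,
   whose image is [A i] again. *)
rewrite -(haar_translate i Vu); last by have := mB i; rewrite /B ij eqxx.
congr (P (U i @^-1` _)); apply/seteqP; split => W /=.
  by move=> [W' h <-]; exact: h.
by move=> AW; exists (V^t* * (W : M)); rewrite /preimage/= ?mulmxE mulrA VV mul1r.
Qed.
End HaarSystem.

Section HaarInvariance.
Variables (R : realType) (n k : nat) (d : measure_display) (T : measurableType d).
Variables (P : probability T R) (U : 'I_k -> {RV P >-> mxborel R n}).
Hypotheses (haarU : forall i, standard_unitary (U i)) (indU : independent_RVs U).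
Local Notation C := (Cplx R).
Local Notation M := 'M[C]_n.+1.
Local Notation BM := (mxborel R n).
Local Notation unitarized := (unitarized U).

Lemma bm_unitarized : bm_family (probability_expectation P) unitarized.
Proof.
move=> i a b; apply: bounded_measurable_entry; first exact: measurable_unitarized.
by move=> w; exact: unitarize_unitary.
Qed.

Lemma complex_expectation_tuple (f g : T -> k.-tuple BM) (F : k.-tuple BM -> C) :
  measurable_fun setT f -> measurable_fun setT g ->
  (forall A : 'I_k -> set BM, (forall i, measurable (A i)) ->
    P [set w | forall i, A i (tnth (f w) i)] =
    P [set w | forall i, A i (tnth (g w) i)]) ->
  (forall Q : probability (k.-tuple BM) R, bm (probability_expectation Q) F) ->
  complex_expectation P (F \o f) = complex_expectation P (F \o g).
Proof.
move=> mf mg fg mF.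
pose X : {RV P >-> k.-tuple BM} :=
  MeasurableFun.Pack (MeasurableFun.Class (isMeasurableFun.Build _ _ _ _ f mf)).
pose Y : {RV P >-> k.-tuple BM} :=
  MeasurableFun.Pack (MeasurableFun.Class (isMeasurableFun.Build _ _ _ _ g mg)).
rewrite -(@complex_expectation_distribution _ _ _ _ _ P X F (mF (distribution P X))).
rewrite -(@complex_expectation_distribution _ _ _ _ _ P Y F (mF (distribution P Y))).
by apply: eq_complex_expectation; apply: eq_tuple_probability => A mA; exact: fg.
Qed.

Lemma unitarized_left_invariant (I : Type) (D : I -> M) :
  left_invariant (probability_expectation P) unitarized D.
Proof.
move=> j V VV X Y a b.
(* Unitarizing once more makes [F] bounded on all tuples, not merely on unitary ones. *)
pose u (v : k.-tuple BM) i : M := unitarize (tnth v i).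
pose F v := word_mx (u v) D X a b * ntr (word_mx (u v) D Y).
pose tup (g : T -> 'I_k -> M) w : k.-tuple BM := [tuple (g w i : BM) | i < k].
have mtup g : (forall i, measurable_fun setT (fun w => g w i : BM)) ->
    measurable_fun setT (tup g).
  move=> mg; apply/measurable_fun_tnthP => i.
  by apply: eq_measurable_fun (mg i) => w _; rewrite /tup /= tnth_mktuple.
have Ftup g w : (forall i, g w i \is unitarymx) ->
    F (tup g w) = word_mx (g w) D X a b * ntr (word_mx (g w) D Y).
  move=> ug; suff -> : g w = u (tup g w) by [].
  by apply: funext => i; rewrite /u tnth_mktuple unitarize_id.
have uU w i : unitarized w i \is unitarymx by exact: unitarize_unitary.
have Vu : V \is unitarymx by apply/unitarymxP.
have uV w i : translate (unitarized w) j V i \is unitarymx.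
  rewrite /translate; case: (i == j); last exact: uU.
  by rewrite -mulmxE; apply: mul_unitarymx; [exact: Vu|exact: uU].
transitivity (complex_expectation P (F \o tup (fun w => translate (unitarized w) j V))).
  by congr complex_expectation; apply: funext => w; apply/esym/Ftup => i; exact: uV.
transitivity (complex_expectation P (F \o tup unitarized)); last first.
  by congr complex_expectation; apply: funext => w; apply/Ftup => i; exact: uU.
apply: complex_expectation_tuple.
- apply: mtup => i; rewrite /translate; case: eqP => _; last exact: measurable_unitarized.
  exact: (measurableT_comp (@measurable_mulmxl R n V) (measurable_unitarized U i)).
- by apply: mtup => i; exact: measurable_unitarized.
- move=> A mA.
  have E g : [set w | forall i, A i (tnth (tup g w) i)] = [set w | forall i, A i (g w i)].
    by apply/seteqP; split => w /= h i; have := h i; rewrite tnth_mktuple.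
  by rewrite !E; exact: unitarized_translate_law.
- move=> Q; have bu : bm_family (probability_expectation Q) u.
    move=> i x y; apply: bounded_measurable_entry.
      exact: (measurableT_comp (@measurable_unitarize R n) (@measurable_tnth _ BM k i)).
    by move=> w; exact: unitarize_unitary.
  by apply: bmM; [exact: bm_word|exact: bm_ntr_word].
Qed.

End HaarInvariance.

(** * Schatten norms *)

Section Schatten.
Variables (R : realType) (n : nat).
Local Notation C := (Cplx R).
Local Notation M := 'M[C]_n.+1.
Implicit Types (A H K : M) (f g : C -> C).

Lemma specfunE f A :
  specfun f A = (spectralmx A)^t* * diag_mx (map_mx f (spectral_diag A)) * spectralmx A.
Proof. by rewrite /specfun invmx_unitary ?spectral_unitarymx. Qed.

Lemma spectralmxK A : spectralmx A * (spectralmx A)^t* = 1.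
Proof. by apply/unitarymxP; exact: spectral_unitarymx. Qed.

Lemma specfunM f g A : specfun f A * specfun g A = specfun (fun z => f z * g z) A.
Proof.
rewrite !specfunE -!mulrA; congr (_ * _); rewrite !mulrA; congr (_ * _).
rewrite -[X in X * _]mulrA spectralmxK mulr1 -mulmxE mulmx_diag; congr diag_mx.
by apply/rowP => i; rewrite !mxE.
Qed.

Lemma eq_specfun f g A :
  (forall i, f (spectral_diag A 0 i) = g (spectral_diag A 0 i)) ->
  specfun f A = specfun g A.
Proof.
move=> fg; rewrite !specfunE.
rewrite (_ : map_mx f (spectral_diag A) = map_mx g (spectral_diag A))//.
by apply/rowP => i; rewrite !mxE.
Qed.

Lemma specfunX f A m : specfun f A ^+ m.+1 = specfun (fun z => f z ^+ m.+1) A.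
Proof.
elim: m => [|m IH]; first by rewrite expr1; apply: eq_specfun => i; rewrite expr1.
by rewrite exprS IH specfunM; apply: eq_specfun => i; rewrite -exprS.
Qed.

Lemma adj_specfun f A : (forall i, 0 <= f (spectral_diag A 0 i)) ->
  (specfun f A)^t* = specfun f A.
Proof.
move=> f0; rewrite !specfunE !adjmxM trmxCK mulrA tr_diag_mx map_diag_mx.
rewrite (_ : map_mx _ (map_mx f _) = map_mx f (spectral_diag A))//.
by apply/rowP => i; rewrite !mxE; apply/CrealP/ger0_real.
Qed.

Lemma ntr_specfun_ge0 f A : (forall i, 0 <= f (spectral_diag A 0 i)) ->
  0 <= ntr (specfun f A).
Proof.
move=> f0; rewrite specfunE ntrC mulrA spectralmxK mul1r.
rewrite /ntr mulr_ge0 ?invr_ge0// mxtrace_diag; apply: sumr_ge0 => i _.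
by rewrite mxE.
Qed.

Lemma gram_specfun K : K * K^t* = specfun id (K * K^t*).
Proof.
have : K * K^t* \is normalmx by apply/normalmxP; rewrite !mulmxE adjmxM trmxCK.
move/orthomx_spectralP => {1}->; rewrite /specfun.
rewrite (_ : map_mx id _ = spectral_diag (K * K^t*))//.
by apply/rowP => i; rewrite mxE.
Qed.

(** In the eigenbasis S the matrix is again a Gram matrix, (S K)(S K)^*, and its diagonal entries
    are sums of squared moduli. *)
Lemma gram_spectral_diag_ge0 K i : 0 <= spectral_diag (K * K^t*) 0 i.
Proof.
set S := spectralmx (K * K^t*).
have SS : S * S^t* = 1 by exact: spectralmxK.
have : (S * K) * (S * K)^t* = diag_mx (map_mx id (spectral_diag (K * K^t*))).
  rewrite adjmxM mulrA -(mulrA S) {1}gram_specfun specfunE -/S !mulrA.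
  by rewrite SS mul1r -mulrA SS mulr1.
move/matrixP/(_ i i); rewrite [in RHS]mxE eqxx [in RHS]mxE mulr1n => <-.
rewrite mxE; apply: sumr_ge0 => k _.
by rewrite !mxE -normCK exprn_ge0.
Qed.

Lemma mxpowR_mxabs A m : (0 < m)%N ->
  mxpowR (mxabs A) (m.*2)%:R = (A^t* * A) ^+ m.
Proof.
case: m => // m _; rewrite /mxabs mulmxE.
set G := A^t* * A.
have GG : G = A^t* * (A^t*)^t* by rewrite trmxCK.
have GE : G = specfun id G by rewrite GG -gram_specfun.
have Gd i : 0 <= spectral_diag G 0 i.
  by rewrite GG; exact: gram_spectral_diag_ge0.
(* [mxpowR] diagonalizes |A| afresh, with no visible link to the eigenbasis of [G]. A fourth root of
   [G] exhibits |A| as a Gram matrix K K^*, so that its own spectral decomposition is valid with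
   eigenvalues >= 0. *)
pose K := specfun (fun z => sqrtC (sqrtC z)) G.
have HK : specfun (fun z : C => sqrtC z) G = K * K^t*.
  rewrite /K adj_specfun; last by move=> i; rewrite !sqrtC_ge0.
  by rewrite specfunM; apply: eq_specfun => i; rewrite -expr2 sqrtCK.
rewrite /mxpowR; transitivity ((specfun (fun z : C => sqrtC z) G) ^+ m.+1.*2).
  rewrite HK [in RHS]gram_specfun doubleS specfunX; apply: eq_specfun => i.
  rewrite powR_mulrn; last first.
    by rewrite -ler0c RRe_real ?ger0_real// gram_spectral_diag_ge0.
  by rewrite rmorphXn/= RRe_real ?ger0_real// gram_spectral_diag_ge0.
have HH : specfun (fun z : C => sqrtC z) G * specfun (fun z : C => sqrtC z) G = G.
  rewrite specfunM [RHS]GE; apply: eq_specfun => i.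
  by rewrite -expr2 sqrtCK.
by rewrite -mul2n exprM expr2 HH.
Qed.

Lemma schatten_power_bound k A (B : R) :
  schatten (2 ^ k.+1)%:R A <= B -> power_bound k (B ^+ (2 ^ k.+1))%:C%C A.
Proof.
have k0 : (0 < 2 ^ k)%N by rewrite expn_gt0.
rewrite /schatten expnS mul2n mxpowR_mxabs// /trn -/(ntr _) /power_bound.
set x := ntr _; set N := (2 ^ k).*2.
have x0 : 0 <= x.
  have GG : A^t* * A = A^t* * (A^t*)^t* by rewrite trmxCK.
  rewrite /x GG gram_specfun.
  case: (2 ^ k)%N k0 => // m _; rewrite specfunX; apply: ntr_specfun_ge0 => i.
  by apply: exprn_ge0; exact: gram_spectral_diag_ge0.
have rex : (complex.Re x)%:C%C = x by rewrite RRe_real// ger0_real.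
have r0 : 0 <= complex.Re x by rewrite -ler0c rex.
have N0 : N%:R != 0 :> R by rewrite pnatr_eq0 double_eq0 -lt0n.
move=> h; rewrite ger0_norm// -rex lecR.
have <- : (complex.Re x `^ N%:R^-1) ^+ N = complex.Re x.
  by rewrite -powR_mulrn ?powR_ge0// -powRrM mulVf// powRr1.
by rewrite lerXn2r ?nnegrE ?powR_ge0// (le_trans _ h)// powR_ge0.
Qed.
End Schatten.

(** * Assembling the word *)

Section NonMeasurableIntegrand.
Import HBNNSimple.

(* f need not be measurable: a negative power in word_trace is an inverse in the
   ring of all matrices, which is not controlled off the unitary group. *)
Lemma integral_le_ae (R : realType) d (T : measurableType d)
    (mu : {measure set T -> \bar R}) (f g : T -> \bar R) :
  (forall x, 0 <= f x)%E -> (forall x, 0 <= g x)%E -> measurable_fun setT g ->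
  {ae mu, forall x, (f x <= g x)%E} ->
  (\int[mu]_x f x <= \int[mu]_x g x)%E.
Proof.
(* The integral of [f] is a supremum over simple functions below [f]; these are measurable and
   almost everywhere below [g]. *)
move=> f0 g0 mg fg; rewrite (ge0_integralTE mu f0).
apply: ub_ereal_sup => _ [h hf <-].
rewrite -integralT_nnsfun; apply: ae_ge0_le_integral => //.
- by move=> x _; rewrite lee_fin; exact: fun_ge0.
- exact/measurable_EFinP.
- by apply: filterS fg => x fgx _; exact: le_trans (hf x) fgx.
Qed.

End NonMeasurableIntegrand.

(** [S] is arbitrary, while the words need indices with decidable equality and the laws need finite
    tuples. Only the finitely many values of [s] matter. *)
Lemma finite_relabel (I : finType) (S : Type) (s : I -> S) :
  exists (k : nat) (t : 'I_k -> S) (c : I -> 'I_k),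
    injective t /\ forall i, s i = t (c i).
Proof.
pose us : seq {classic S} := undup [seq (s i : {classic S}) | i <- enum I].
have sin i : (s i : {classic S}) \in us.
  by rewrite mem_undup; apply/mapP; exists i; rewrite ?mem_enum.
exists (size us), (fun j => tnth (in_tuple us) j).
exists (fun i => Ordinal (etrans (index_mem _ us) (sin i))); split.
  have inj : injective (tnth (in_tuple us)) by apply/tuple_uniqP; exact: undup_uniq.
  by move=> i j /inj.
by move=> i; rewrite (tnth_nth (s i : {classic S})) /= nth_index.
Qed.

Section Blocks.
Variables (C : numClosedFieldType) (J I : eqType).
Local Notation letter := (letter J I).

Definition power_block (m : int) (j : J) : seq letter :=
  nseq `|m|%N (0 <= m, inl j).

Lemma word_mx_power_block n (U : J -> 'M[C]_n.+1) (D : I -> 'M[C]_n.+1) m j :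
  unitary_family U -> word_mx U D (power_block m j) = exprz (U j) m.
Proof.
move=> Uu; rewrite /word_mx /power_block big_nseq iter_mulr_1 /letter_mx/=.
case: m => p //=; rewrite NegzE/= -exprnN -exprVn; congr (_ ^+ _).
have UU : U j \is unitarymx by apply/unitarymxP; exact: mulmx1C (Uu j).
by rewrite -[RHS]/(invmx (U j)) invmx_unitary.
Qed.

Lemma word_mx_flatten n (U : J -> 'M[C]_n.+1) (D : I -> 'M[C]_n.+1)
    (T : Type) (r : seq T) (w : T -> seq letter) :
  word_mx U D (flatten [seq w i | i <- r]) = \prod_(i <- r) word_mx U D (w i).
Proof.
elim: r => [|i r IH]; first by rewrite big_nil word_mx_nil.
by rewrite /= word_mx_cat IH big_cons.
Qed.

(** Nonzero exponents make every block begin with a unitary letter, so constants are never adjacent,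
    and two blocks that meet without a constant between them have different indices. *)
Lemma reduced_flatten (T : Type) (r : seq T) (m : T -> int) (c : T -> J)
    (cen : T -> bool) (e : T -> I) :
  (forall i, m i != 0) -> sorted (fun i i' => cen i || (c i != c i')) r ->
  reduced (flatten [seq power_block (m i) (c i) ++
    (if cen i then [:: (true, inr (e i))] else [::]) | i <- r]).
Proof.
move=> m0; elim: r => [//|i r IH] /= red.
have {IH} := IH (path_sorted red); set W := flatten _ => redW.
have mpos x : `|m x|%N = `|m x|.-1.+1.
  by rewrite prednK// absz_gt0.
rewrite /power_block mpos /= /reduced /=.
set a := (0 <= m i, inl (c i)).
have pa p : path (@compatible J I) a (nseq p a) by elim: p => //= p ->; rewrite /compatible/= !eqxx.
have la p : last a (nseq p a) = a by elim: p.
rewrite -catA cat_path pa la /=.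
have W0 : W = [::] \/ exists i' W', [/\ W = (0 <= m i', inl (c i')) :: W' &
    cen i || (c i != c i')].
  rewrite /W; case: r red {redW W} => [|i' r] red; first by left.
  right; exists i'; rewrite /= /power_block [X in nseq X]mpos /=; eexists; split => //.
  by move: red => /= /andP[].
case: (cen i) W0 => /= -[W0|[i' [W' [WE cc]]]].
- by rewrite W0.
- by move: redW; rewrite WE /reduced/=.
- by rewrite W0.
- move: redW; rewrite WE /reduced/= => ->; rewrite andbT /compatible /a /=.
  by rewrite cc.
Qed.
End Blocks.

Lemma sorted_index_enum_ord l (e : rel 'I_l) :
  (forall i i' : 'I_l, i' = i.+1 :> nat -> e i i') -> sorted e (index_enum 'I_l).
Proof.
move=> he; rewrite /index_enum unlock -enumT.
apply: (@sub_sorted _ (fun i i' : 'I_l => (i' == i.+1 :> nat))).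
  by move=> i i' /eqP; exact: he.
have -> : sorted (fun i i' : 'I_l => (i' == i.+1 :> nat)) (enum 'I_l) =
    sorted (fun x y => y == x.+1) (map val (enum 'I_l)). by rewrite [RHS]sorted_map.
rewrite val_enum_ord.
case: l {e he} => // l; elim: l 0%N => //= l IH x.
by rewrite eqxx; exact: IH.
Qed.

Section Main.
Variables (R : realType) (l : nat) (S : Type) (s : 'I_l -> S) (m : 'I_l -> int).
Variables (k : nat) (t : 'I_k -> S) (c : 'I_l -> 'I_k).
Hypotheses (t_inj : injective t) (stc : forall r, s r = t (c r)).
Hypothesis m0 : forall r, m r != 0.
Local Notation C := (Cplx R).

Definition block_word (cen : 'I_l -> bool) : seq (letter 'I_k 'I_l) :=
  flatten [seq power_block 'I_l (m r) (c r) ++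
    (if cen r then [:: (true, inr r)] else [::]) | r <- index_enum 'I_l].

Lemma size_block_word cen : (size (block_word cen) <= \sum_r `|m r|.+1)%N.
Proof.
rewrite /block_word size_flatten /shape -map_comp sumnE big_map.
apply: leq_sum => r _ /=; rewrite size_cat size_nseq.
by case: (cen r) => /=; lia.
Qed.

Lemma nconst_block_word cen : (nconst (block_word cen) <= l)%N.
Proof.
rewrite /nconst /block_word count_flatten -map_comp sumnE big_map.
apply: leq_trans (_ : \sum_(r < l) 1 <= _)%N; last by rewrite sum1_card card_ord.
apply: leq_sum => r _ /=; rewrite count_cat count_nseq /= mul0n add0n.
by case: (cen r).
Qed.

Lemma reduced_block_word cen :
  (forall r, ~~ cen r -> s r <> s (ordS r)) -> reduced (block_word cen).
Proof.
move=> hs; apply: (@reduced_flatten _ _ _ _ m c cen id) => //.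
apply: sorted_index_enum_ord => i i' ii'; case: (boolP (cen i)) => //= /hs.
have -> : ordS i = i' by apply/val_inj; rewrite /= -ii' modn_small.
by rewrite !stc => h; apply/eqP => cc; apply: h; rewrite cc.
Qed.

Lemma block_word_gt0 cen : (0 < l)%N -> (0 < size (block_word cen))%N.
Proof.
move=> l0; rewrite /block_word size_flatten /shape -map_comp sumnE big_map.
rewrite (bigD1 (Ordinal l0))//= size_cat size_nseq.
by have := m0 (Ordinal l0); rewrite -absz_gt0; lia.
Qed.

Lemma word_trace_block_word n cen (U : S -> 'M[C]_n.+1) (D D' : 'I_l -> 'M[C]_n.+1) :
  (forall i, (U (t i))^t* * U (t i) = 1) ->
  (forall r, if cen r then D' r = D r else D r = 1%:M) ->
  word_trace s m U D = ntr (word_mx (fun i => U (t i)) D' (block_word cen)).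
Proof.
move=> Uu hD; rewrite /word_trace /block_word word_mx_flatten /trn -/(ntr _).
congr ntr; apply: eq_bigr => r _.
rewrite word_mx_cat word_mx_power_block// -stc; congr (_ * _).
by have := hD r; case: (cen r) => h; rewrite ?word_mx1 ?word_mx_nil /letter_mx/= h.
Qed.

Lemma second_moment_bound_relabelled (B : R -> R) (J : set R) : (0 < l)%N ->
  J (2 ^ l.+1)%:R -> second_moment_bound s m B J.
Proof.
move=> l0 Jp; pose N := (2 ^ l.+1)%N.
(* The hypothesis bounds tr |D|^N by B(N)^N; adding 1 provides the requirement 1 <= b. *)
pose b0 : R := 1 + `|B N%:R ^+ N|; pose b : C := b0%:C%C.
have b1 : 1 <= b by rewrite -[1]/(1%:C%C) lecR lerDl.
have lk : (2 * l < 2 ^ l.+1)%N by rewrite expnS ltn_pmul2l// ltn_expl.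
have [K K0 HK] := @moment2_boundE C 'I_k 'I_l b l l b1 lk (\sum_r `|m r|.+1).
(* The estimate holds in every dimension, so the rank can be 0. *)
exists (complex.Re K), 0%N => d T P U D haarU indU adm n _.
pose cen r := `[< forall n : nat, trn (D r n) = 0 /\
  (forall p, J p -> schatten p (D r n) <= B p) >].
have notcen r : ~~ cen r -> (forall n, D r n = 1%:M) /\ s r <> s (ordS r).
  by move=> /asboolPn hr; case: (adm r).
(* The dropped identities are replaced by 0, which is centered and bounded; their indices do not
   occur in [block_word cen]. *)
pose D' r := if cen r then D r n else 0.
pose Ut (i : 'I_k) := U n (t i).
have haarUt i : standard_unitary (Ut i) by exact: haarU.
have indUt : independent_RVs Ut.
  by move=> k' t' A t'_inj mA; apply: (indU n k' (t \o t')) => //; exact: inj_comp.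
pose x := block_word cen.
have sys : @centered_system C 'I_k 'I_l b l (T n) n
    (probability_expectation (P n)) (unitarized Ut) D'.
  split.
  - by move=> w; exact: unitarized_family.
  - exact: bm_unitarized.
  - exact: unitarized_left_invariant.
  - move=> r; rewrite /D'; case: (boolP (cen r)) => [/asboolP hr|_].
      apply: le_trans (schatten_power_bound ((hr n).2 _ Jp)) _.
      by rewrite /b lecR /b0; apply: le_trans (ler_norm _) _; rewrite lerDr.
    rewrite /power_bound mulr0 expr0n expn_eq0/=.
    by rewrite /ntr raddf0 mul0r normr0; exact: le_trans ler01 b1.
  - move=> r; rewrite /D'; case: (boolP (cen r)) => [/asboolP hr|_]; first exact: (hr n).1.
    by rewrite /ntr raddf0 mul0r.
have := HK _ _ _ _ _ sys x (reduced_block_word (fun r h => (notcen r h).2)).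
rewrite block_word_gt0// size_block_word nconst_block_word => /(_ isT isT).
rewrite /moment2 /=; set f := fun w => `|_| ^+ 2.
have bf : bounded_measurable f.
  have h := @bm_ntr_word C n 'I_k 'I_l _ (probability_expectation (P n)) D' _ x (bm_unitarized Ut).
  have := bmM h (bm_conj h); congr (bounded_measurable _).
  by apply: funext => w; rewrite /f normCK.
move=> hle.
have reK : \int[P n]_w complex.Re (f w) <= complex.Re K / n.+1%:R ^+ 2.
  have KE : K / n.+1%:R ^+ 2 = (complex.Re K / n.+1%:R ^+ 2)%:C%C :> C.
    by rewrite rmorphM fmorphV rmorphXn rmorph_nat /= RRe_real ?ger0_real.
  by move: hle; rewrite KE lecE => /andP[].
have [[mre _] [Kf fKf]] := bf.
have f0 w : 0 <= complex.Re (f w).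
  have : 0 <= f w by rewrite exprn_ge0.
  by rewrite lecE => /andP[].
apply: le_trans (_ : (\int[P n]_w (complex.Re (f w))%:E <= _)%E); last first.
  rewrite -[X in (X <= _)%E]fineK ?lee_fin//.
  apply: integrable_fin_num => //.
  by apply: (@bounded_integrable R _ _ (P n) (fun w => complex.Re (f w)) Kf) => // w; exact: (fKf w).1.
(* The original integrand agrees almost surely with the measurable [f], built from the unitarized
   matrices. *)
rewrite unlock; apply: integral_le_ae.
- by move=> w; rewrite lee_fin sqr_ge0.
- by move=> w; rewrite lee_fin.
- exact/measurable_EFinP.
have unit_ae i : {ae P n, forall w, (Ut i w : 'M[C]_n.+1) \is unitarymx}.
  have mS := measurable_preimage_rv Ut i (@measurable_unitary_set R n).
  exists (~` (Ut i @^-1` @unitary_set R n)); split => //; first exact: measurableC.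
  by have := probability_setC (P n) mS; rewrite (haar_unitary haarUt i) subee.
have := @filter_forall _ _ _ _ (ae_filter_ringOfSetsType (P n)) unit_ae.
apply: filterS => w uw; rewrite lee_fin.
have uE : unitarized Ut w = fun i => Ut i w.
  by apply: funext => i; rewrite /unitarized unitarize_id.
rewrite /f uE (@word_trace_block_word n cen (fun a => U n a w) (D ^~ n) D').
- rewrite -/x; set z := ntr _.
  by rewrite -[in leRHS](RRe_real (normr_real z)) -rmorphXn.
- by move=> i; apply: mulmx1C; apply/unitarymxP; exact: uw.
- by move=> r; rewrite /D'; case: (boolP (cen r)) => [//|/notcen[h _]]; exact: h.
Qed.
End Main.

Theorem theorem3p1 (R : realType) (l : nat) (l_gt0 : (0 < l)%N) :
  (forall (S : Type) (s : 'I_l -> S) (m : 'I_l -> int) (B : R -> R),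
     (forall r, m r != 0) -> (forall p, 1 <= p -> 0 <= B p) ->
     second_moment_bound s m B [set p | 1 <= p]) /\
  (exists pl : R, 1 <= pl /\
     forall (S : Type) (s : 'I_l -> S) (m : 'I_l -> int) (B : R -> R),
       (forall r, m r != 0) -> (forall p, 1 <= p -> 0 <= B p) ->
       second_moment_bound s m B [set p | 1 <= p <= pl]).
Proof.
have p1 : 1 <= (2 ^ l.+1)%:R :> R by rewrite ler1n expn_gt0.
(* p_l = 2^(l+1) is the one exponent at which the norms are used, so both claims are instances of
   the same bound. *)
split; last exists (2 ^ l.+1)%:R; last split=> //.
all: move=> S s m B m0 _; have [k [t [c [t_inj stc]]]] := finite_relabel s.
all: by apply: (second_moment_bound_relabelled t_inj stc) => //=; rewrite p1 lexx.
Qed.
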